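(* Let $g$ be a real-analytic function with $g(0)=0$, $g'(0)=1$, and let $G(x)=\int_0^xg(\xi)\,d\xi$ be the potential of $\ddot x+g(x)=0$; suppose hypothesis (H) stated in the context holds. Put $$\mathcal F(x)=g(x)^2+\frac{g''(0)}3\,g(x)^3-2G(x)g'(x)+\left(\frac{7\,g''(0)^3}{9}-\frac{g^{(4)}(0)}5\right)g(x)^3G(x).$$ If $\mathcal F(x)>0$ (respectively $\mathcal F(x)<0$) for $\bar a<x<\bar b$, then $T'(c)>0$ (respectively $T'(c)<0$) for $0<c<\bar c$. So a sufficient condition for $\ddot x+g(x)=0$ to have an isochronous center is $\mathcal F(x)=0$ (identically), or equivalently $$\frac{d}{dx}\left[\frac{G(x)}{g(x)^2}\right]=\alpha+\beta\,G(x),$$ where $$\alpha=-\frac{g''(0)}3,\qquad \beta=-\left(\frac{7\,g''(0)^3}{9}-\frac{g^{(4)}(0)}5\right)\neq0 .$$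
   Context: Hypothesis (H): there exist $a<0<b$ such that $G(a)=G(b)=c$, and $G(x)<c$ and $x\,g(x)>0$ for all $a<x<b$, $x\neq0$. Under these conditions the system $\dot x=y$, $\dot y=-g(x)$ has a periodic orbit of energy $c$ with turning points $a,b$, where $\bar a<a<0<b<\bar b$ for some $\bar a,\bar b$, and the origin is a center. The minimal period of this orbit is $T(c)=\sqrt2\int_a^b\frac{dx}{\sqrt{c-G(x)}}$; it is defined and analytic for $0<c<\bar c$, where, when $\bar c<+\infty$, $\bar c$ is the energy of the homoclinic orbit, with turning points $\bar a<0<\bar b$. The center at the origin is called isochronous if all periodic orbits near $(0,0)$ have the same minimal period. *)

(* Defs.v *)
(* Concrete real numbers of the standard library, with Coquelicot. *)
From Stdlib Require Import Reals.
From Coquelicot Require Import Coquelicot.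
Open Scope R_scope.

Definition analytic_at (f : R -> R) (x0 : R) : Prop :=
  exists a : nat -> R, locally x0 (fun x => is_pseries a (x - x0) (f x)).

(* The force [g] lives on the open interval ]l, r[, with extended real
   endpoints; its values outside of it play no role. *)
Definition in_dom (l r : Rbar) (x : R) : Prop := Rbar_lt l x /\ Rbar_lt x r.

Definition potential (g : R -> R) (x : R) : R := RInt g 0 x.

(* Hypothesis (H) at energy [c], with turning points [a] and [b]. *)
Definition turning_points (g : R -> R) (l r : Rbar) (c a b : R) : Prop :=
  in_dom l r a /\ in_dom l r b /\ a < 0 < b /\
  potential g a = c /\ potential g b = c /\
  forall x, a < x < b -> x <> 0 -> potential g x < c /\ 0 < x * g x.

(* The energies satisfying (H) form an interval starting at 0 (excluded), and
   the corresponding intervals ]a, b[ are nested; their union corresponds to the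
   whole family of periodic orbits around the origin.  All three bounds may be
   infinite. *)
Definition energy_sup (g : R -> R) (l r : Rbar) : Rbar :=
  Lub_Rbar (fun c => exists a b, turning_points g l r c a b).

Definition left_end (g : R -> R) (l r : Rbar) : Rbar :=
  Glb_Rbar (fun a => exists c b, turning_points g l r c a b).

Definition right_end (g : R -> R) (l r : Rbar) : Rbar :=
  Lub_Rbar (fun b => exists c a, turning_points g l r c a b).

(* The turning points are determined by [c], so [iota] picks a unique value;
   the integral is improper at both ends. *)
Definition period (g : R -> R) (l r : Rbar) (c : R) : R :=
  iota (fun t : R => exists a b, turning_points g l r c a b /\
    t = sqrt 2 * RInt_gen (fun x => 1 / sqrt (c - potential g x))
                          (at_right a) (at_left b)).

Definition is_solution (g : R -> R) (l r : Rbar) (x y : R -> R) : Prop :=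
  forall t, in_dom l r (x t) /\
    is_derive x t (y t) /\ is_derive y t (- g (x t)).

Definition is_period (x y : R -> R) (T : R) : Prop :=
  forall t, x (t + T) = x t /\ y (t + T) = y t.

(* Equilibria have no minimal period in this sense. *)
Definition is_minimal_period (x y : R -> R) (T : R) : Prop :=
  0 < T /\ is_period x y T /\
  forall S, 0 < S -> is_period x y S -> T <= S.

Definition is_center (g : R -> R) (l r : Rbar) : Prop :=
  exists delta, 0 < delta /\
    forall p q, 0 < p ^ 2 + q ^ 2 < delta ^ 2 ->
      exists x y T, is_solution g l r x y /\ x 0 = p /\ y 0 = q /\
        is_minimal_period x y T.

Definition is_isochronous_center (g : R -> R) (l r : Rbar) : Prop :=
  is_center g l r /\
  exists delta T0, 0 < delta /\
    forall x y T, is_solution g l r x y -> is_minimal_period x y T ->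
      (forall t, x t ^ 2 + y t ^ 2 < delta ^ 2) -> T = T0.

Definition calF (g : R -> R) (x : R) : R :=
  g x ^ 2 + Derive_n g 2 0 / 3 * g x ^ 3
  - 2 * potential g x * Derive g x
  + (7 * Derive_n g 2 0 ^ 3 / 9 - Derive_n g 4 0 / 5)
    * g x ^ 3 * potential g x.

Definition alpha (g : R -> R) : R := - (Derive_n g 2 0 / 3).

Definition beta (g : R -> R) : R :=
  - (7 * Derive_n g 2 0 ^ 3 / 9 - Derive_n g 4 0 / 5).

(* Main.v *)
(* In the coordinate u = sign(x) sqrt(2 G(x)), with inverse x = X(u), an orbit of
   energy c = rho^2/2 is the circle u = rho sin s, y = rho cos s, and dt = X'(u) ds
   along it; hence its period is twice the integral of X'(rho sin s) over
   [-pi/2, pi/2], and one may differentiate under the integral sign.  Here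
   X'' = (g^2 - 2 G g') / g^3 = calF / g^3 + alpha + beta G, whose second part
   is even in u and contributes nothing, so that T' has the sign of calF.

   If calF vanishes, then X'(u) = 1 + alpha u + beta u^3 / 6: the time along each
   orbit is an explicit function of the angle s that increases by 2 pi at each
   turn.  Uniqueness of solutions shows that all small orbits are of this form. *)

Require Import Defs.
From Stdlib Require Import Reals Lra Ranalysis5 ClassicalEpsilon.
From Coquelicot Require Import Coquelicot.
Open Scope R_scope.

(** The expressions for X' and X'' as functions of position, u/g and (g^2 - 2 G g')/g^3, have the
    form 0/0 at the bottom of the well. Differentiating under the integral sign requires X'' to be
    continuous there as well. The limits 1 and -g''(0)/3 come from successive mean value arguments,
    and the second one is the origin of [alpha]. The other obstacle lies at the turning points: the
    integrand of the period is singular there, and at the ends of a well the force may vanish. The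
    orbit of energy c is therefore always studied inside a well of strictly larger energy. There X
    is twice continuously differentiable around [-rho, rho], and the integral over the angle is
    proper. An energy strictly below the supremum always leaves this room. In the isochronous case
    no existence theorem is invoked: inverting the explicit time as a function of the angle yields a
    solution defined for all times. Uniqueness is local, on a neighbourhood of the origin where [g]
    is Lipschitz, so the constructed orbits must also be shown to stay small. *)

(** * Differential calculus *)

(* Goals coming from Coquelicot may state equality in a structure over [R] that
   [ring] and [field] do not recognize. *)
Ltac real_eq := lazymatch goal with |- @eq _ ?u ?v => change (@eq R u v) end.

Lemma locally_between (a b x : R) :
  a < x < b -> locally x (fun y => a < y < b).
Proof.
  intros H; exact (open_and _ _ (open_gt a) (open_lt b) x H).
Qed.

Lemma continuous_eps (f : R -> R) (x : R) :
  continuous f x <->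
  forall eps : posreal, locally x (fun y => Rabs (f y - f x) < eps).
Proof.
  split.
  - intros H eps. apply (H (fun z => Rabs (z - f x) < eps)). now exists eps.
  - intros H P [eps He].
    apply filter_imp with (2 := H eps). intros y Hy; apply He, Hy.
Qed.

Lemma is_derive_continuous (f : R -> R) (x d : R) :
  is_derive f x d -> continuous f x.
Proof.
  intros H; apply (ex_derive_continuous (V := R_NormedModule)); now exists d.
Qed.

Lemma is_derive_eq (f : R -> R) (x d d' : R) :
  is_derive f x d -> d = d' -> is_derive f x d'.
Proof. now intros H <-. Qed.

(** By the mean value theorem the difference quotient at [x0] is a value of [df] at an intermediate
    point, and [df] is continuous at [x0]. This carries the derivative formulas of [amplitude] and
    [stretch] across the origin. *)
Lemma is_derive_removable (f df : R -> R) (x0 : R) :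
  continuous f x0 ->
  locally x0 (fun x => x <> x0 -> is_derive f x (df x)) ->
  continuous df x0 ->
  is_derive f x0 (df x0).
Proof.
  intros Cf Df Cdf. apply is_derive_Reals. intros eps Heps.
  destruct (filter_and _ _ Df (proj1 (continuous_eps _ _) Cdf (mkposreal _ Heps)))
    as [d Hd].
  exists d. intros h Hh Hhd.
  assert (Hin : forall z, Rmin x0 (x0 + h) <= z <= Rmax x0 (x0 + h) ->
                  ball x0 d z).
  { intros z Hz. change (Rabs (z - x0) < d).
    revert Hhd Hz. unfold Rmin, Rmax, Rabs.
    destruct (Rle_dec x0 (x0 + h)); repeat destruct Rcase_abs; lra. }
  destruct (MVT_gen f x0 (x0 + h) df) as [z [Hz Ez]].
  - intros z Hz. apply (Hd z).
    + apply Hin; lra.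
    + intros ->. revert Hz. unfold Rmin, Rmax.
      destruct (Rle_dec x0 (x0 + h)); lra.
  - intros z Hz. apply continuity_pt_filterlim.
    destruct (Req_dec z x0) as [->|Hz0]; [exact Cf|].
    apply (is_derive_continuous f z (df z)). apply (Hd z); auto.
  - replace ((f (x0 + h) - f x0) / h) with (df z).
    + apply (Hd z), Hin, Hz.
    + rewrite Ez. field; lra.
Qed.

(* Cauchy's mean value theorem against a power of [x]. *)
Lemma is_lim_div_pow (f df : R -> R) (n : nat) (l : R) :
  f 0 = 0 ->
  locally 0 (fun x => is_derive f x (df x)) ->
  is_lim (fun x => df x / x ^ n) 0 l ->
  is_lim (fun x => f x / x ^ (S n)) 0 (l / INR (S n)).
Proof.
  intros f0 Df Hl. apply is_lim_spec. apply is_lim_spec in Hl.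
  intros eps.
  assert (HS : 0 < INR (S n)) by apply lt_0_INR, Nat.lt_0_succ.
  assert (HS1 : 1 <= INR (S n)) by (rewrite S_INR; pose proof (pos_INR n); lra).
  destruct (Hl eps) as [d1 H1]. destruct Df as [d2 H2].
  assert (Hd : 0 < Rmin d1 d2) by (apply Rmin_pos; apply cond_pos).
  exists (mkposreal _ Hd). intros x Hx Hx0.
  change (Rabs (x - 0) < Rmin d1 d2) in Hx. rewrite Rminus_0_r in Hx.
  pose proof (Rmin_l d1 d2). pose proof (Rmin_r d1 d2).
  assert (HB : exists z, z <> 0 /\ Rabs z <= Rabs x /\
      f x * (INR (S n) * z ^ n) = df z * x ^ S n).
  (* Rolle's auxiliary function: it vanishes at both 0 and x, so its derivative vanishes at some z
     strictly between them. *)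
  { set (F := fun s => f s * x ^ S n - f x * s ^ S n).
    set (dF := fun s => df s * x ^ S n - f x * (INR (S n) * s ^ n)).
    assert (DF : forall z, Rabs z <= Rabs x -> derivable_pt_lim F z (dF z)).
    { intros z Hz. apply is_derive_Reals. unfold F, dF.
      apply (is_derive_minus (V := R_NormedModule) (fun s => f s * x ^ S n)).
      - apply (is_derive_eq _ _ (df z * x ^ S n)); [|reflexivity].
        apply is_derive_ext with (fun t => scal (x ^ S n) (f t)).
        { intros t; apply Rmult_comm. }
        eapply is_derive_eq.
        + apply is_derive_scal, H2. change (Rabs (z - 0) < d2).
          rewrite Rminus_0_r. lra.
        + apply Rmult_comm.
      - auto_derive; [easy|]. change (pred (S n)) with n.
        change (match n with 0%nat => 1 | S _ => INR n + 1 end) with (INR (S n)). ring. }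
    assert (F0 : F 0 = 0) by (unfold F; rewrite f0; simpl; ring).
    assert (Fx : F x = 0) by (unfold F; ring).
    destruct (Rdichotomy _ _ Hx0) as [Hn|Hp].
    - destruct (MVT_cor2 F dF x 0 Hn) as [z [Ez Hz]].
      + intros z Hz; apply DF. rewrite !Rabs_left1; lra.
      + exists z. split; [lra|]. split; [rewrite !Rabs_left1; lra|].
        rewrite F0, Fx in Ez. assert (dF z = 0) by nra. unfold dF in *; lra.
    - destruct (MVT_cor2 F dF 0 x Hp) as [z [Ez Hz]].
      + intros z Hz; apply DF. rewrite !Rabs_pos_eq; lra.
      + exists z. split; [lra|]. split; [rewrite !Rabs_pos_eq; lra|].
        rewrite F0, Fx in Ez. assert (dF z = 0) by nra. unfold dF in *; lra. }
  destruct HB as [z [Hz0 [Hzx Ez]]].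
  replace (f x / x ^ S n) with ((df z / z ^ n) / INR (S n)).
  - assert (Hz : Rabs (df z / z ^ n - l) < eps).
    { apply H1; [|exact Hz0]. change (Rabs (z - 0) < d1).
      rewrite Rminus_0_r. lra. }
    replace (df z / z ^ n / INR (S n) - l / INR (S n))
      with ((df z / z ^ n - l) / INR (S n)) by (field; split; [lra|apply pow_nonzero, Hz0]).
    unfold Rdiv at 1. rewrite Rabs_mult, (Rabs_pos_eq (/ _)).
    + apply Rle_lt_trans with (2 := Hz).
      rewrite <- (Rmult_1_r (Rabs (df z / z ^ n - l))) at 2.
      apply Rmult_le_compat_l; [apply Rabs_pos|].
      rewrite <- Rinv_1. apply Rinv_le_contravar; lra.
    + left. now apply Rinv_0_lt_compat.
  - pose proof (pow_nonzero x (S n) Hx0). pose proof (pow_nonzero z n Hz0).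
    revert Ez H1 H3 H4 HS.
    generalize (x ^ S n), (z ^ n), (INR (S n)), (f x), (df z). intros A B k p q Ez _ HA HB Hk.
    apply (Rmult_eq_reg_r (A * k * B)).
    + transitivity (q * A); [field; split; auto; lra|].
      rewrite <- Ez. field; auto.
    + repeat apply Rmult_integral_contrapositive_currified; auto; lra.
Qed.

Lemma is_lim_continuous_ext (f h : R -> R) (l : R) :
  is_lim f 0 l -> h 0 = l -> locally 0 (fun x => x <> 0 -> h x = f x) ->
  continuous h 0.
Proof.
  intros Hl h0 He. apply continuous_eps. intros eps.
  apply is_lim_spec in Hl.
  assert (He' : locally' 0 (fun x => h x = f x)) by exact He.
  destruct (filter_and _ _ (Hl eps) He') as [d Hd].
  exists d. intros y Hy. destruct (Req_dec y 0) as [->|Hy0].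
  - rewrite Rminus_diag, Rabs_R0. apply cond_pos.
  - destruct (Hd y Hy Hy0) as [H1 H2]. now rewrite h0, H2.
Qed.

(** Monotonicity alone gives this: once v lies between the values of [f] at [X v0 - e] and
    [X v0 + e], the point [X v] is trapped between these two points. *)
Lemma continuous_right_inverse (f X : R -> R) (D E : R -> Prop) (v0 : R) :
  (forall x y, D x -> D y -> x < y -> f x < f y) ->
  open D -> locally v0 E ->
  (forall v, E v -> D (X v) /\ f (X v) = v) ->
  continuous X v0.
Proof.
  intros Hinc HD HE HX. apply continuous_eps. intros eps.
  destruct (HX v0 (locally_singleton _ _ HE)) as [DX0 EX0].
  destruct (HD _ DX0) as [d Hd].
  set (e := Rmin (eps / 2) (d / 2)).
  assert (He : 0 < e /\ e < eps /\ e < d).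
  { pose proof (cond_pos eps). pose proof (cond_pos d). unfold e, Rmin.
    destruct Rle_dec; lra. }
  assert (Dm : D (X v0 - e)).
  { apply Hd. change (Rabs (X v0 - e - X v0) < d). rewrite Rabs_left; lra. }
  assert (Dp : D (X v0 + e)).
  { apply Hd. change (Rabs (X v0 + e - X v0) < d). rewrite Rabs_pos_eq; lra. }
  assert (Hv : f (X v0 - e) < v0 < f (X v0 + e)).
  { pose proof (Hinc _ _ Dm DX0 ltac:(lra)). pose proof (Hinc _ _ DX0 Dp ltac:(lra)). lra. }
  apply filter_imp with (2 := filter_and _ _ HE (locally_between _ _ _ Hv)).
  intros v [Ev Hv']. destruct (HX v Ev) as [DX EX].
  assert (X v0 - e < X v).
  { apply Rnot_le_lt. intros Hle. destruct (Rle_lt_or_eq_dec _ _ Hle) as [Hlt|Heq].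
    - pose proof (Hinc _ _ DX Dm Hlt). lra.
    - rewrite <- Heq in Hv'. lra. }
  assert (X v < X v0 + e).
  { apply Rnot_le_lt. intros Hle. destruct (Rle_lt_or_eq_dec _ _ Hle) as [Hlt|Heq].
    - pose proof (Hinc _ _ Dp DX Hlt). lra.
    - rewrite Heq in Hv'. lra. }
  apply Rabs_def1; lra.
Qed.

(** Carathéodory's form of the derivative: the slope [q] of [f] at [X v0], completed by the value d,
    is continuous at that point, and the difference quotient of [X] is the reciprocal of [q] at
    [X (v0 + h)]. *)
Lemma is_derive_right_inverse (f X : R -> R) (v0 d : R) :
  locally v0 (fun v => f (X v) = v) ->
  continuous X v0 ->
  is_derive f (X v0) d -> d <> 0 ->
  is_derive X v0 (/ d).
Proof.
  intros Hf CX Df Hd.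
  set (q := fun x => if Req_EM_T x (X v0) then d else (f x - f (X v0)) / (x - X v0)).
  assert (Cq : continuous q (X v0)).
  { apply continuous_eps. intros eps. apply is_derive_Reals in Df.
    destruct (Df eps (cond_pos eps)) as [e He]. exists e. intros y Hy.
    change (Rabs (y - X v0) < e) in Hy. unfold q at 2.
    destruct (Req_EM_T (X v0) (X v0)) as [_|]; [|easy]. unfold q.
    destruct (Req_EM_T y (X v0)) as [|n].
    - rewrite Rminus_diag, Rabs_R0. apply cond_pos.
    - specialize (He (y - X v0)). rewrite Rplus_minus in He.
      apply He; [lra|exact Hy]. }
  assert (q0 : q (X v0) = d) by (unfold q; now destruct Req_EM_T).
  assert (CqX : continuous (fun v => / q (X v)) v0).
  { apply (continuous_comp (fun v => q (X v)) Rinv).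
    - now apply continuous_comp.
    - apply continuous_Rinv. now rewrite q0. }
  apply is_derive_Reals. intros eps Heps.
  destruct (filter_and _ _ Hf (proj1 (continuous_eps _ _) CqX (mkposreal _ Heps)))
    as [e He].
  exists e. intros h Hh Hhe.
  destruct (He (v0 + h)) as [E1 E2].
  { change (Rabs (v0 + h - v0) < e). now replace (v0 + h - v0) with h by ring. }
  simpl in E2. rewrite q0 in E2.
  pose proof (locally_singleton _ _ Hf) as E0. simpl in E0.
  replace ((X (v0 + h) - X v0) / h) with (/ q (X (v0 + h))); [exact E2|].
  assert (Hne : X (v0 + h) <> X v0) by (intros Hc; rewrite Hc in E1; lra).
  unfold q. destruct Req_EM_T as [|_]; [easy|].
  rewrite E1, E0. field. split; lra.
Qed.

(** * The amplitude coordinate *)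

(** Completing the quotient by its limit turns limits at 0 into continuity, which is stable under
    products, inverses and square roots. *)
Definition quotient_pow (f : R -> R) (n : nat) (l x : R) : R :=
  if Req_EM_T x 0 then l else f x / x ^ n.

Lemma continuous_quotient_pow (f : R -> R) (n : nat) (l : R) :
  continuous (quotient_pow f n l) 0 <-> is_lim (fun x => f x / x ^ n) 0 l.
Proof.
  assert (E0 : quotient_pow f n l 0 = l).
  { unfold quotient_pow. now destruct Req_EM_T. }
  split.
  - intros H. apply is_lim_spec. intros eps.
    destruct (proj1 (continuous_eps _ _) H eps) as [d Hd]. exists d.
    intros y Hy Hy0. specialize (Hd y Hy). rewrite E0 in Hd.
    revert Hd. unfold quotient_pow. now destruct Req_EM_T.
  - intros H. apply (is_lim_continuous_ext _ _ _ H E0).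
    apply filter_forall. intros x Hx. unfold quotient_pow. now destruct Req_EM_T.
Qed.

(** What is retained of an analytic force on one well. Regularity includes the ends, so that the
    amplitude is continuous up to them; the sign condition stays in the interior, because an end may
    be an equilibrium. *)
Record well (g : R -> R) (a b : R) : Prop := {
  well_zero : a < 0 < b;
  well_level : potential g a = potential g b;
  well_potential : forall x, a <= x <= b -> is_derive (potential g) x (g x);
  well_derive : forall x, a <= x <= b -> is_derive g x (Derive g x);
  well_derive2 : forall x, a <= x <= b -> is_derive (Derive g) x (Derive_n g 2 x);
  well_continuous2 : forall x, a <= x <= b -> continuous (Derive_n g 2) x;
  well_force0 : g 0 = 0;
  well_slope0 : Derive g 0 = 1;
  well_sign : forall x, a < x < b -> x <> 0 -> 0 < x * g x }.

(* The signed square root of [2 G], written so that it is smooth at [0]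
   (where it takes the value [0] because of the first factor). *)
Definition amplitude (g : R -> R) (x : R) : R :=
  x * sqrt (2 * potential g x / x ^ 2).

(* The derivative of the inverse of [amplitude g], as a function of position. *)
Definition stretch (g : R -> R) (x : R) : R :=
  if Req_EM_T x 0 then 1 else amplitude g x / g x.

(* The second derivative of the inverse of [amplitude g], as a function of
   position. *)
Definition shear (g : R -> R) (x : R) : R :=
  if Req_EM_T x 0 then - (Derive_n g 2 0 / 3)
  else (g x ^ 2 - 2 * potential g x * Derive g x) / g x ^ 3.

Lemma potential_0 (g : R -> R) : potential g 0 = 0.
Proof. exact (RInt_point (V := R_CompleteNormedModule) 0 g). Qed.

Lemma amplitude_0 (g : R -> R) : amplitude g 0 = 0.
Proof. apply Rmult_0_l. Qed.

Lemma potential_pos (g : R -> R) (a b x : R) :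
  well g a b -> a <= x <= b -> x <> 0 -> 0 < potential g x.
Proof.
  intros W Hx Hx0. pose proof (potential_0 g) as G0.
  pose proof (well_zero _ _ _ W) as Hab.
  destruct (Rdichotomy _ _ Hx0) as [Hn|Hp].
  - destruct (MVT_cor2 (potential g) g x 0 Hn) as [z [Ez Hz]].
    + intros z Hz. apply is_derive_Reals, (well_potential _ _ _ W); lra.
    + assert (0 < z * g z) by (apply (well_sign _ _ _ W); lra). nra.
  - destruct (MVT_cor2 (potential g) g 0 x Hp) as [z [Ez Hz]].
    + intros z Hz. apply is_derive_Reals, (well_potential _ _ _ W); lra.
    + assert (0 < z * g z) by (apply (well_sign _ _ _ W); lra). nra.
Qed.

Lemma well_force_neq_0 (g : R -> R) (a b x : R) :
  well g a b -> a < x < b -> x <> 0 -> g x <> 0.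
Proof.
  intros W Hx Hx0 E. pose proof (well_sign _ _ _ W x Hx Hx0). nra.
Qed.

Lemma amplitude_sqr (g : R -> R) (a b x : R) :
  well g a b -> a <= x <= b -> amplitude g x ^ 2 = 2 * potential g x.
Proof.
  intros W Hx. unfold amplitude. destruct (Req_dec x 0) as [->|Hx0].
  - rewrite potential_0. ring.
  - pose proof (potential_pos _ _ _ _ W Hx Hx0).
    rewrite Rpow_mult_distr, pow2_sqrt.
    + field. auto.
    + apply Rlt_le, Rdiv_lt_0_compat; [lra|]. now apply pow2_gt_0.
Qed.

Lemma amplitude_sign (g : R -> R) (a b x : R) :
  well g a b -> a <= x <= b -> x <> 0 -> 0 < x * amplitude g x.
Proof.
  intros W Hx Hx0. unfold amplitude.
  pose proof (potential_pos _ _ _ _ W Hx Hx0).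
  pose proof (pow2_gt_0 _ Hx0).
  assert (0 < sqrt (2 * potential g x / x ^ 2)).
  { apply sqrt_lt_R0, Rdiv_lt_0_compat; lra. }
  nra.
Qed.

Lemma amplitude_pos (g : R -> R) (a b x : R) :
  well g a b -> 0 < x <= b -> amplitude g x = sqrt (2 * potential g x).
Proof.
  intros W Hx. pose proof (well_zero _ _ _ W).
  rewrite <- (amplitude_sqr g a b x W) by lra.
  rewrite sqrt_pow2; [reflexivity|].
  pose proof (amplitude_sign g a b x W ltac:(lra) ltac:(lra)). nra.
Qed.

Lemma amplitude_neg (g : R -> R) (a b x : R) :
  well g a b -> a <= x < 0 -> amplitude g x = - sqrt (2 * potential g x).
Proof.
  intros W Hx. pose proof (well_zero _ _ _ W).
  rewrite <- (amplitude_sqr g a b x W) by lra.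
  replace (amplitude g x ^ 2) with ((- amplitude g x) ^ 2) by ring.
  rewrite sqrt_pow2; [ring|].
  pose proof (amplitude_sign g a b x W ltac:(lra) ltac:(lra)). nra.
Qed.

(** * Removable singularities at the bottom of the well *)

Lemma well_near_0 (g : R -> R) (a b : R) :
  well g a b -> locally 0 (fun x => a < x < b).
Proof. intros W. exact (locally_between _ _ _ (well_zero _ _ _ W)). Qed.

(** First of a chain of three limits, for g/x, G/x^2 and (g^2 - 2 G g')/x^3; each reduces to the
    quotient of the derivatives, of one degree less. Here that quotient has exponent 0 and is g'
    itself. *)
Lemma continuous_force_quotient (g : R -> R) (a b : R) :
  well g a b -> continuous (quotient_pow g 1 1) 0.
Proof.
  intros W. apply continuous_quotient_pow.
  replace 1 with (1 / INR 1) at 1 by (simpl; field).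
  apply (is_lim_div_pow g (Derive g)).
  - apply (well_force0 _ _ _ W).
  - apply filter_imp with (2 := well_near_0 _ _ _ W).
    intros x Hx. apply (well_derive _ _ _ W). lra.
  - apply continuous_quotient_pow.
    apply continuous_ext with (Derive g).
    + intros x. unfold quotient_pow. destruct Req_EM_T as [->|].
      * exact (well_slope0 _ _ _ W).
      * simpl. field.
    + eapply is_derive_continuous, (well_derive2 _ _ _ W).
      pose proof (well_zero _ _ _ W). lra.
Qed.

Lemma continuous_potential_quotient (g : R -> R) (a b : R) :
  well g a b -> continuous (quotient_pow (potential g) 2 (1 / 2)) 0.
Proof.
  intros W. apply continuous_quotient_pow.
  apply (is_lim_div_pow (potential g) g 1).
  - apply potential_0.
  - apply filter_imp with (2 := well_near_0 _ _ _ W).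
    intros x Hx. apply (well_potential _ _ _ W). lra.
  - apply continuous_quotient_pow, (continuous_force_quotient _ _ _ W).
Qed.

Lemma quotient_pow_0 (f : R -> R) (n : nat) (l : R) :
  quotient_pow f n l 0 = l.
Proof. unfold quotient_pow. now destruct Req_EM_T. Qed.

(* [g^2 - 2 G g'] has derivative [- 2 G g'']. *)
Lemma continuous_defect_quotient (g : R -> R) (a b : R) :
  well g a b ->
  continuous (quotient_pow (fun x => g x ^ 2 - 2 * potential g x * Derive g x) 3
                (- (Derive_n g 2 0 / 3))) 0.
Proof.
  intros W. apply continuous_quotient_pow.
  replace (- (Derive_n g 2 0 / 3)) with (- Derive_n g 2 0 / INR 3)
    by (simpl INR; field).
  apply (is_lim_div_pow _ (fun x => - 2 * potential g x * Derive_n g 2 x)).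
  - rewrite (well_force0 _ _ _ W), potential_0. ring.
  - apply filter_imp with (2 := well_near_0 _ _ _ W). intros x Hx.
    assert (Hx' : a <= x <= b) by lra.
    pose proof (well_potential _ _ _ W x Hx') as D0.
    pose proof (well_derive _ _ _ W x Hx') as D1.
    pose proof (well_derive2 _ _ _ W x Hx') as D2.
    eapply is_derive_eq.
    + apply (is_derive_minus (V := R_NormedModule) (fun s => g s ^ 2)
               (fun s => 2 * potential g s * Derive g s)).
      * apply is_derive_pow, D1.
      * apply (is_derive_mult (fun s => 2 * potential g s)).
        -- apply is_derive_scal, D0.
        -- exact D2.
        -- intros; apply Rmult_comm.
    + unfold minus, plus, opp, mult; simpl. ring.
  - apply continuous_quotient_pow.
    apply continuous_ext with
      (fun x => - 2 * quotient_pow (potential g) 2 (1 / 2) x * Derive_n g 2 x).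
    + intros x. unfold quotient_pow. destruct Req_EM_T as [->|]; real_eq; [field|].
      field; auto.
    + apply (continuous_mult (fun x => - 2 * quotient_pow (potential g) 2 (1 / 2) x)).
      * apply (continuous_scal_r (-2) (quotient_pow (potential g) 2 (1 / 2))).
        apply (continuous_potential_quotient _ _ _ W).
      * apply (well_continuous2 _ _ _ W). pose proof (well_zero _ _ _ W). lra.
Qed.

(** Dividing numerator and denominator by x^3 leaves completed quotients, with a denominator that
    tends to 1. The same device, with x in place of x^3, serves for [stretch]. *)
Lemma continuous_shear_0 (g : R -> R) (a b : R) :
  well g a b -> continuous (shear g) 0.
Proof.
  intros W. set (k := quotient_pow g 1 1).
  set (d := quotient_pow (fun x => g x ^ 2 - 2 * potential g x * Derive g x) 3
                (- (Derive_n g 2 0 / 3))).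
  apply continuous_ext_loc with (fun x => d x * / (k x * (k x * k x))).
  - apply filter_imp with (2 := well_near_0 _ _ _ W). intros x Hx.
    unfold shear, d, k, quotient_pow. destruct Req_EM_T as [|Hx0]; real_eq; [field|].
    pose proof (well_force_neq_0 _ _ _ _ W Hx Hx0). field; auto.
  - pose proof (continuous_force_quotient _ _ _ W : continuous k 0) as Ck.
    apply (continuous_mult d (fun x => / (k x * (k x * k x)))).
    + apply (continuous_defect_quotient _ _ _ W).
    + apply (continuous_comp (fun x => k x * (k x * k x)) Rinv).
      * apply (continuous_mult k (fun x => k x * k x)); [|apply (continuous_mult k k)]; exact Ck.
      * apply continuous_Rinv. unfold k. rewrite quotient_pow_0. lra.
Qed.

Lemma continuous_stretch_0 (g : R -> R) (a b : R) :
  well g a b -> continuous (stretch g) 0.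
Proof.
  intros W. set (k := quotient_pow g 1 1).
  set (d := quotient_pow (potential g) 2 (1 / 2)).
  apply continuous_ext_loc with (fun x => sqrt (2 * d x) * / k x).
  - apply filter_imp with (2 := well_near_0 _ _ _ W). intros x Hx.
    unfold stretch, amplitude, d, k, quotient_pow. destruct Req_EM_T as [|Hx0]; real_eq.
    + replace (2 * (1 / 2)) with 1 by field. rewrite sqrt_1. field.
    + pose proof (well_force_neq_0 _ _ _ _ W Hx Hx0).
      replace (2 * potential g x / x ^ 2) with (2 * (potential g x / x ^ 2))
        by (field; auto).
      field; auto.
  - apply (continuous_mult (fun x => sqrt (2 * d x)) (fun x => / k x)).
    + apply (continuous_comp (fun x => 2 * d x) sqrt); [|apply continuous_sqrt].
      apply (continuous_scal_r 2 d), (continuous_potential_quotient _ _ _ W).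
    + apply (continuous_comp k Rinv).
      * apply (continuous_force_quotient _ _ _ W).
      * apply continuous_Rinv. unfold k. rewrite quotient_pow_0. lra.
Qed.

(** This is u u' = g, the derivative of u^2 = 2 G. It also covers the ends of the well, where u does
    not vanish. *)
Lemma is_derive_amplitude_neq_0 (g : R -> R) (a b x : R) :
  well g a b -> a <= x <= b -> x <> 0 ->
  is_derive (amplitude g) x (g x / amplitude g x).
Proof.
  intros W Hx Hx0. pose proof (potential_pos _ _ _ _ W Hx Hx0) as HG.
  assert (Hs : 0 < 2 * potential g x / x ^ 2).
  { apply Rdiv_lt_0_compat; [lra|]. now apply pow2_gt_0. }
  pose proof (well_potential _ _ _ W x Hx) as DG.
  assert (Hq : 0 < sqrt (2 * potential g x / x ^ 2)) by now apply sqrt_lt_R0.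
  assert (Eq : sqrt (2 * potential g x / x ^ 2) ^ 2 = 2 * potential g x / x ^ 2)
    by (apply pow2_sqrt; lra).
  unfold amplitude. auto_derive.
  - split; [now exists (g x)|]. split; [apply (pow_nonzero x 2 Hx0)|]. split; [|easy].
    replace (2 * potential g x * / (x * (x * 1))) with (2 * potential g x / x ^ 2)
      by reflexivity. exact Hs.
  - change (x * (x * 1)) with (x ^ 2).
    change (2 * potential g x * / x ^ 2) with (2 * potential g x / x ^ 2).
    replace (Derive (fun x0 : R => potential g x0) x) with (g x)
      by (symmetry; now apply is_derive_unique).
    revert Hq Eq. generalize (sqrt (2 * potential g x / x ^ 2)). intros q Hq Eq.
    assert (EG : 2 * potential g x = q ^ 2 * x ^ 2) by (rewrite Eq; field; auto).
    replace (potential g x) with (q ^ 2 * x ^ 2 / 2) by lra.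
    field. split; lra || auto.
Qed.

Lemma stretch_pos (g : R -> R) (a b x : R) :
  well g a b -> a < x < b -> 0 < stretch g x.
Proof.
  intros W Hx. unfold stretch. destruct Req_EM_T as [|Hx0]; [lra|].
  pose proof (well_sign _ _ _ W x Hx Hx0).
  pose proof (amplitude_sign g a b x W ltac:(lra) Hx0).
  destruct (Rdichotomy _ _ Hx0).
  - replace (amplitude g x / g x) with ((- amplitude g x) / (- g x)) by (field; nra).
    apply Rdiv_lt_0_compat; nra.
  - apply Rdiv_lt_0_compat; nra.
Qed.

Lemma stretch_0 (g : R -> R) : stretch g 0 = 1.
Proof. unfold stretch. now destruct Req_EM_T. Qed.

Lemma stretch_mult (g : R -> R) (a b x : R) :
  well g a b -> a < x < b -> stretch g x * g x = amplitude g x.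
Proof.
  intros W Hx. unfold stretch. destruct Req_EM_T as [->|Hx0].
  - rewrite amplitude_0, (well_force0 _ _ _ W). ring.
  - pose proof (well_force_neq_0 _ _ _ _ W Hx Hx0). field; auto.
Qed.

Lemma continuous_amplitude (g : R -> R) (a b x : R) :
  well g a b -> a <= x <= b -> continuous (amplitude g) x.
Proof.
  intros W Hx. destruct (Req_dec x 0) as [->|Hx0].
  - apply continuous_ext_loc with (fun x => stretch g x * g x).
    + apply filter_imp with (2 := well_near_0 _ _ _ W).
      intros y; apply (stretch_mult _ _ _ _ W).
    + apply (continuous_mult (stretch g) g).
      * apply (continuous_stretch_0 _ _ _ W).
      * eapply is_derive_continuous, (well_derive _ _ _ W _ Hx).
  - eapply is_derive_continuous, is_derive_amplitude_neq_0; eauto.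
Qed.

Lemma is_derive_amplitude (g : R -> R) (a b x : R) :
  well g a b -> a < x < b -> is_derive (amplitude g) x (/ stretch g x).
Proof.
  intros W Hx.
  assert (Hne : forall y, a < y < b -> y <> 0 ->
            is_derive (amplitude g) y (/ stretch g y)).
  { intros y Hy Hy0. apply is_derive_eq with (g y / amplitude g y).
    - apply is_derive_amplitude_neq_0 with a b; auto; lra.
    - unfold stretch. destruct Req_EM_T; [easy|].
      pose proof (well_force_neq_0 _ _ _ _ W Hy Hy0).
      pose proof (amplitude_sign g a b y W ltac:(lra) Hy0).
      field. split; nra. }
  destruct (Req_dec x 0) as [->|Hx0]; [|auto].
  apply (is_derive_removable (amplitude g) (fun y => / stretch g y)).
  - apply continuous_amplitude with a b; auto; lra.
  - apply filter_imp with (2 := well_near_0 _ _ _ W). auto.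
  - apply (continuous_comp (stretch g) Rinv).
    + apply (continuous_stretch_0 _ _ _ W).
    + apply continuous_Rinv. rewrite stretch_0. lra.
Qed.

(** Since X' is [stretch] evaluated at X, the chain rule reads X'' = stretch' * stretch; the
    quotient by [stretch] is thus what makes [shear] equal to X''. The formula itself follows from
    u' = g/u and u^2 = 2 G. *)
Lemma is_derive_stretch (g : R -> R) (a b x : R) :
  well g a b -> a < x < b -> is_derive (stretch g) x (shear g x / stretch g x).
Proof.
  intros W Hx.
  assert (Hne : forall y, a < y < b -> y <> 0 ->
            is_derive (stretch g) y (shear g y / stretch g y)).
  { intros y Hy Hy0.
    pose proof (well_force_neq_0 _ _ _ _ W Hy Hy0) as Hg.
    pose proof (amplitude_sign g a b y W ltac:(lra) Hy0) as Hu.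
    pose proof (amplitude_sqr g a b y W ltac:(lra)) as Eu.
    apply is_derive_ext_loc with (fun z => amplitude g z / g z).
    { destruct (Rdichotomy _ _ Hy0) as [Hn|Hp].
      - apply filter_imp with (2 := locally_between a 0 y ltac:(lra)).
        intros z Hz. unfold stretch. destruct Req_EM_T; [lra|easy].
      - apply filter_imp with (2 := locally_between 0 b y ltac:(lra)).
        intros z Hz. unfold stretch. destruct Req_EM_T; [lra|easy]. }
    eapply is_derive_eq.
    - apply (is_derive_div (amplitude g) g).
      + apply (is_derive_amplitude_neq_0 g a b y W ltac:(lra) Hy0).
      + apply (well_derive _ _ _ W). lra.
      + exact Hg.
    - unfold shear, stretch. destruct Req_EM_T; [easy|].
      rewrite <- Eu. field. repeat split; auto; nra. }
  destruct (Req_dec x 0) as [->|Hx0]; [|auto].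
  apply (is_derive_removable (stretch g) (fun y => shear g y / stretch g y)).
  - apply (continuous_stretch_0 _ _ _ W).
  - apply filter_imp with (2 := well_near_0 _ _ _ W). auto.
  - apply (continuous_mult (shear g) (fun y => / stretch g y)).
    + apply (continuous_shear_0 _ _ _ W).
    + apply (continuous_comp (stretch g) Rinv).
      * apply (continuous_stretch_0 _ _ _ W).
      * apply continuous_Rinv. rewrite stretch_0. lra.
Qed.

Lemma continuous_shear (g : R -> R) (a b x : R) :
  well g a b -> a < x < b -> continuous (shear g) x.
Proof.
  intros W Hx. destruct (Req_dec x 0) as [->|Hx0].
  { apply (continuous_shear_0 _ _ _ W). }
  pose proof (well_force_neq_0 _ _ _ _ W Hx Hx0) as Hg.
  assert (Hx' : a <= x <= b) by lra.
  pose proof (well_potential _ _ _ W x Hx') as D0.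
  pose proof (well_derive _ _ _ W x Hx') as D1.
  pose proof (well_derive2 _ _ _ W x Hx') as D2.
  apply continuous_ext_loc with
    (fun z => (g z ^ 2 - 2 * potential g z * Derive g z) / g z ^ 3).
  { destruct (Rdichotomy _ _ Hx0) as [Hn|Hp].
    - apply filter_imp with (2 := locally_between a 0 x ltac:(lra)).
      intros z Hz. unfold shear. destruct Req_EM_T; [lra|easy].
    - apply filter_imp with (2 := locally_between 0 b x ltac:(lra)).
      intros z Hz. unfold shear. destruct Req_EM_T; [lra|easy]. }
  apply (ex_derive_continuous (V := R_NormedModule)).
  apply (ex_derive_div (fun z => g z ^ 2 - 2 * potential g z * Derive g z)).
  - apply (ex_derive_minus (V := R_NormedModule) (fun z => g z ^ 2)).
    + apply ex_derive_pow. now eexists; apply D1.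
    + apply (ex_derive_mult (fun z => 2 * potential g z)).
      * apply ex_derive_scal. now eexists; apply D0.
      * now eexists; apply D2.
  - apply ex_derive_pow. now eexists; apply D1.
  - now apply pow_nonzero.
Qed.

(** * The inverse of the amplitude *)

(** The power series has a positive radius of convergence: it converges at distance [e / 2], so its
    terms tend to 0 there, which is impossible outside the disk of convergence. Inside the disk it
    can be differentiated termwise. *)
Lemma analytic_ex_derive_n (f : R -> R) (x0 : R) (n : nat) :
  analytic_at f x0 -> ex_derive_n f n x0.
Proof.
  intros [a [e He]].
  assert (Hr : Rbar_lt 0 (CV_radius a)).
  { pose proof (cond_pos e) as He0.
    destruct (Rbar_lt_le_dec 0 (CV_radius a)) as [|Hle]; [assumption|].
    exfalso. apply (CV_disk_outside a (e / 2)).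
    - apply Rbar_le_lt_trans with (1 := Hle). simpl. rewrite Rabs_pos_eq; lra.
    - apply ex_series_lim_0. exists (f (x0 + e / 2)).
      apply is_series_ext with (fun k => scal (pow_n (e / 2) k) (a k)).
      + intros k. rewrite pow_n_pow. apply Rmult_comm.
      + specialize (He (x0 + e / 2)).
        replace (x0 + e / 2 - x0) with (e / 2) in He by ring.
        apply He. change (Rabs (x0 + e / 2 - x0) < e).
        replace (x0 + e / 2 - x0) with (e / 2) by ring. rewrite Rabs_pos_eq; lra. }
  apply ex_derive_n_ext_loc with (fun x => PSeries a (x + - x0)).
  - exists e. intros y Hy. apply is_pseries_unique, (He y Hy).
  - apply ex_derive_n_comp_trans, ex_derive_n_PSeries.
    now rewrite Rplus_opp_r, Rabs_R0.
Qed.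

Lemma in_dom_between (l r : Rbar) (x y z : R) :
  in_dom l r x -> in_dom l r y -> x <= z <= y -> in_dom l r z.
Proof.
  intros [Hx _] [_ Hy] [Hxz Hzy]. split.
  - apply Rbar_lt_le_trans with x; assumption.
  - apply Rbar_le_lt_trans with y; assumption.
Qed.

Lemma in_dom_open (l r : Rbar) (x : R) : in_dom l r x -> locally x (in_dom l r).
Proof.
  intros H.
  exact (open_and _ _ (open_Rbar_gt l) (open_Rbar_lt r) x H).
Qed.

Lemma is_derive_potential (g : R -> R) (l r : Rbar) (x : R) :
  in_dom l r 0 -> (forall y, in_dom l r y -> continuous g y) ->
  in_dom l r x -> is_derive (potential g) x (g x).
Proof.
  intros H0 C Hx. apply (is_derive_RInt (V := R_NormedModule) g (potential g) 0).
  - apply filter_imp with (2 := in_dom_open _ _ _ Hx). intros y Hy.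
    apply (RInt_correct (V := R_CompleteNormedModule)), ex_RInt_continuous.
    intros z Hz. apply C. revert Hz. unfold Rmin, Rmax.
    destruct Rle_dec; intros Hz.
    + apply in_dom_between with 0 y; auto.
    + apply in_dom_between with y 0; auto.
  - now apply C.
Qed.

Lemma turning_points_well (g : R -> R) (l r : Rbar) (c a b : R) :
  in_dom l r 0 -> (forall x, in_dom l r x -> analytic_at g x) ->
  g 0 = 0 -> Derive g 0 = 1 ->
  turning_points g l r c a b -> well g a b.
Proof.
  intros D0 An g0 dg0 (Da & Db & Hab & Ga & Gb & Hs).
  assert (Hd : forall x, a <= x <= b -> in_dom l r x).
  { intros x; now apply in_dom_between. }
  assert (E : forall n x, in_dom l r x ->
            is_derive (Derive_n g n) x (Derive_n g (S n) x)).
  { intros n x Hx. apply Derive_correct.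
    apply (analytic_ex_derive_n g x (S n)), An, Hx. }
  constructor; auto.
  - now rewrite Ga.
  - intros x Hx. apply (is_derive_potential g l r); auto. intros y Hy.
    apply (is_derive_continuous _ _ _ (E 0%nat y Hy)).
  - intros x Hx. apply (E 0%nat), Hd, Hx.
  - intros x Hx. apply (E 1%nat), Hd, Hx.
  - intros x Hx. apply (is_derive_continuous _ _ _ (E 2%nat x (Hd x Hx))).
  - intros x Hx Hx0. now apply Hs.
Qed.

(** The amplitude of the well: since the potential is the same at both ends, [amplitude] maps ]a,
    b[ onto the symmetric interval ]-radius, radius[. *)
Definition radius (g : R -> R) (a : R) : R := sqrt (2 * potential g a).

Lemma radius_pos (g : R -> R) (a b : R) : well g a b -> 0 < radius g a.
Proof.
  intros W. pose proof (well_zero _ _ _ W).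
  pose proof (potential_pos g a b a W ltac:(lra) ltac:(lra)).
  apply sqrt_lt_R0. lra.
Qed.

Lemma radius_sqr (g : R -> R) (a b : R) :
  well g a b -> radius g a ^ 2 = 2 * potential g a.
Proof.
  intros W. pose proof (well_zero _ _ _ W).
  pose proof (potential_pos g a b a W ltac:(lra) ltac:(lra)).
  apply pow2_sqrt. lra.
Qed.

Lemma potential_lt_level (g : R -> R) (a b x : R) :
  well g a b -> a < x < b -> potential g x < potential g a.
Proof.
  intros W Hx. pose proof (well_zero _ _ _ W) as Hab.
  destruct (Rlt_le_dec x 0) as [Hn|Hp].
  - destruct (MVT_cor2 (potential g) g a x (proj1 Hx)) as [z [Ez Hz]].
    + intros z Hz. apply is_derive_Reals, (well_potential _ _ _ W); lra.
    + assert (0 < z * g z) by (apply (well_sign _ _ _ W); lra). nra.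
  - rewrite (well_level _ _ _ W).
    destruct (MVT_cor2 (potential g) g x b (proj2 Hx)) as [z [Ez Hz]].
    + intros z Hz. apply is_derive_Reals, (well_potential _ _ _ W); lra.
    + assert (0 < z * g z) by (apply (well_sign _ _ _ W); lra). nra.
Qed.

Lemma amplitude_range (g : R -> R) (a b x : R) :
  well g a b -> a < x < b -> - radius g a < amplitude g x < radius g a.
Proof.
  intros W Hx. pose proof (radius_pos _ _ _ W).
  pose proof (radius_sqr _ _ _ W). pose proof (potential_lt_level _ _ _ _ W Hx).
  pose proof (amplitude_sqr g a b x W ltac:(lra)). split; nra.
Qed.

Lemma amplitude_increasing (g : R -> R) (a b x y : R) :
  well g a b -> a < x -> x < y -> y < b -> amplitude g x < amplitude g y.
Proof.
  intros W Ha Hxy Hb.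
  apply (incr_function (amplitude g) a b (fun z => / stretch g z)); auto.
  - intros z Hz1 Hz2. now apply is_derive_amplitude with a b.
  - intros z Hz1 Hz2. apply Rinv_0_lt_compat. now apply stretch_pos with a b.
Qed.

Lemma amplitude_surjective (g : R -> R) (a b v : R) :
  well g a b -> - radius g a < v < radius g a ->
  exists x, a < x < b /\ amplitude g x = v.
Proof.
  intros W Hv. pose proof (well_zero _ _ _ W) as Hab.
  assert (Ea : amplitude g a = - radius g a) by (apply (amplitude_neg g a b); auto; lra).
  assert (Eb : amplitude g b = radius g a).
  { unfold radius. rewrite (well_level _ _ _ W). apply (amplitude_pos g a b); auto; lra. }
  destruct (IVT_interv (fun x => amplitude g x - v) a b) as [x [Hx Ex]]; try lra.
  - intros x Hx. apply continuity_pt_filterlim.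
    apply (continuous_minus (V := R_NormedModule) (amplitude g) (fun _ => v)).
    + now apply continuous_amplitude with a b.
    + apply continuous_const.
  - exists x. split; [|lra]. split; apply Rnot_le_lt; intros Hle.
    + replace x with a in Ex by lra. lra.
    + replace x with b in Ex by lra. lra.
Qed.

(** The inverse X of the amplitude, made total by choice; its value is meaningful for v strictly
    between [- radius g a] and [radius g a]. *)
Definition position (g : R -> R) (a b v : R) : R :=
  epsilon (inhabits 0) (fun x => a < x < b /\ amplitude g x = v).

Lemma position_spec (g : R -> R) (a b v : R) :
  well g a b -> - radius g a < v < radius g a ->
  a < position g a b v < b /\ amplitude g (position g a b v) = v.
Proof.
  intros W Hv. apply (epsilon_spec (inhabits 0) (fun x => a < x < b /\ amplitude g x = v)).
  now apply amplitude_surjective.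
Qed.

Lemma position_amplitude (g : R -> R) (a b x : R) :
  well g a b -> a < x < b -> position g a b (amplitude g x) = x.
Proof.
  intros W Hx.
  destruct (position_spec g a b _ W (amplitude_range _ _ _ _ W Hx)) as [Hp Ep].
  destruct (Rtotal_order (position g a b (amplitude g x)) x) as [Hlt|[|Hlt]]; auto.
  - pose proof (amplitude_increasing g a b _ _ W (proj1 Hp) Hlt (proj2 Hx)). lra.
  - pose proof (amplitude_increasing g a b _ _ W (proj1 Hx) Hlt (proj2 Hp)). lra.
Qed.

Lemma position_0 (g : R -> R) (a b : R) : well g a b -> position g a b 0 = 0.
Proof.
  intros W. rewrite <- (amplitude_0 g) at 1. apply position_amplitude; [exact W|].
  exact (well_zero _ _ _ W).
Qed.

Lemma position_sign (g : R -> R) (a b v : R) :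
  well g a b -> - radius g a < v < radius g a -> v <> 0 -> 0 < v * position g a b v.
Proof.
  intros W Hv Hv0. destruct (position_spec g a b v W Hv) as [Hp Ep].
  rewrite <- Ep at 1. rewrite Rmult_comm. apply amplitude_sign with a b; auto; [lra|].
  intros E. rewrite E, amplitude_0 in Ep. auto.
Qed.

Lemma potential_position (g : R -> R) (a b v : R) :
  well g a b -> - radius g a < v < radius g a ->
  potential g (position g a b v) = v ^ 2 / 2.
Proof.
  intros W Hv. destruct (position_spec g a b v W Hv) as [Hp Ep].
  rewrite <- Ep at 2. rewrite (amplitude_sqr g a b); auto; lra.
Qed.

Lemma continuous_position (g : R -> R) (a b v : R) :
  well g a b -> - radius g a < v < radius g a -> continuous (position g a b) v.
Proof.
  intros W Hv.
  apply (continuous_right_inverse (amplitude g) _ (fun x => a < x < b)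
           (fun w => - radius g a < w < radius g a)).
  - intros x y Hx Hy Hxy. apply amplitude_increasing with a b; tauto.
  - intros x; apply locally_between.
  - now apply locally_between.
  - intros w; now apply position_spec.
Qed.

Lemma is_derive_position (g : R -> R) (a b v : R) :
  well g a b -> - radius g a < v < radius g a ->
  is_derive (position g a b) v (stretch g (position g a b v)).
Proof.
  intros W Hv. destruct (position_spec g a b v W Hv) as [Hp Ep].
  pose proof (stretch_pos _ _ _ _ W Hp).
  rewrite <- (Rinv_inv (stretch g _)).
  apply (is_derive_right_inverse (amplitude g)).
  - apply filter_imp with (2 := locally_between _ _ _ Hv).
    intros w Hw. now apply position_spec.
  - now apply continuous_position.
  - now apply is_derive_amplitude with a b.
  - apply Rinv_neq_0_compat. lra.
Qed.

(* The first and second derivatives of the inverse [X] of the amplitude. *)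
Definition speed (g : R -> R) (a b v : R) : R := stretch g (position g a b v).
Definition bend (g : R -> R) (a b v : R) : R := shear g (position g a b v).

Lemma is_derive_speed (g : R -> R) (a b v : R) :
  well g a b -> - radius g a < v < radius g a ->
  is_derive (speed g a b) v (bend g a b v).
Proof.
  intros W Hv. destruct (position_spec g a b v W Hv) as [Hp Ep].
  pose proof (stretch_pos _ _ _ _ W Hp).
  eapply is_derive_eq.
  - apply (is_derive_comp (stretch g) (position g a b)).
    + now apply is_derive_stretch with a b.
    + now apply is_derive_position.
  - unfold scal; simpl; unfold mult; simpl. unfold bend. real_eq. field. lra.
Qed.

Lemma continuous_speed (g : R -> R) (a b v : R) :
  well g a b -> - radius g a < v < radius g a -> continuous (speed g a b) v.
Proof. intros W Hv. eapply is_derive_continuous, is_derive_speed; eauto. Qed.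

Lemma speed_pos (g : R -> R) (a b v : R) :
  well g a b -> - radius g a < v < radius g a -> 0 < speed g a b v.
Proof.
  intros W Hv. apply stretch_pos with a b; auto. now apply position_spec.
Qed.

Lemma continuous_bend (g : R -> R) (a b v : R) :
  well g a b -> - radius g a < v < radius g a -> continuous (bend g a b) v.
Proof.
  intros W Hv. apply (continuous_comp (position g a b) (shear g)).
  - now apply continuous_position.
  - apply continuous_shear with a b; auto. now apply position_spec.
Qed.

(** A single well thus supplies the turning points of all positive lower energies: between X(-rho)
    and X(rho) the amplitude stays in ]-rho, rho[, so G < rho^2/2. *)
Lemma turning_points_position (g : R -> R) (l r : Rbar) (a b rho : R) :
  well g a b -> (forall x, a <= x <= b -> in_dom l r x) ->
  0 < rho < radius g a ->
  turning_points g l r (rho ^ 2 / 2) (position g a b (- rho)) (position g a b rho).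
Proof.
  intros W D Hr.
  assert (H1 : - radius g a < rho < radius g a) by lra.
  assert (H2 : - radius g a < - rho < radius g a) by lra.
  destruct (position_spec g a b rho W H1) as [P1 E1].
  destruct (position_spec g a b (- rho) W H2) as [P2 E2].
  pose proof (position_sign g a b rho W H1 ltac:(lra)).
  pose proof (position_sign g a b (- rho) W H2 ltac:(lra)).
  repeat split; try (apply D; lra); try nra.
  - rewrite potential_position; auto. field.
  - rewrite potential_position; auto.
  - pose proof (amplitude_increasing g a b _ _ W (proj1 P2) (proj1 H3) ltac:(lra)).
    pose proof (amplitude_increasing g a b x _ W ltac:(lra) (proj2 H3) ltac:(lra)).
    pose proof (amplitude_sqr g a b x W ltac:(lra)). nra.
  - apply (well_sign _ _ _ W); auto; lra.
Qed.

(** If two turning points on the same side differed, the inner one would lie inside the outer well,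
    where the potential is strictly below c. This justifies [iota] in [period]. *)
Lemma turning_points_unique (g : R -> R) (l r : Rbar) (c a b a' b' : R) :
  turning_points g l r c a b -> turning_points g l r c a' b' -> a = a' /\ b = b'.
Proof.
  intros (_ & _ & H & Ga & Gb & Hs) (_ & _ & H' & Ga' & Gb' & Hs').
  split.
  - destruct (Rtotal_order a a') as [Hlt|[|Hlt]]; auto; exfalso.
    + destruct (Hs a'); lra.
    + destruct (Hs' a); lra.
  - destruct (Rtotal_order b b') as [Hlt|[|Hlt]]; auto; exfalso.
    + destruct (Hs' b); lra.
    + destruct (Hs b'); lra.
Qed.

(** * The period as a proper integral *)

Lemma is_derive_asin (x : R) : -1 < x < 1 -> is_derive asin x (1 / sqrt (1 - x²)).
Proof.
  intros Hx. apply is_derive_Reals. rewrite <- (derive_pt_asin x Hx).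
  apply derive_pt_eq_1 with (derivable_pt_asin x Hx). reflexivity.
Qed.

(** The derivative of [asin] blows up at 1, so its left limit is read off from the monotonicity of
    [sin]. Taking [e] at most PI/2 makes the threshold [sin (PI / 2 - e)] nonnegative, which keeps y
    in the range where [sin_asin] applies. *)
Lemma asin_near_1 (eps : posreal) :
  exists d : posreal, forall y, 1 - d < y < 1 -> Rabs (asin y - PI / 2) < eps.
Proof.
  pose proof PI_RGT_0. pose proof (cond_pos eps).
  set (e := Rmin (eps / 2) (PI / 2)).
  assert (He : 0 < e /\ e < eps /\ e <= PI / 2).
  { unfold e, Rmin. destruct Rle_dec; lra. }
  assert (Hs : sin (PI / 2 - e) < 1).
  { rewrite <- sin_PI2. apply sin_increasing_1; lra. }
  assert (Hs0 : 0 <= sin (PI / 2 - e)) by (apply sin_ge_0; lra).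
  assert (Hd : 0 < 1 - sin (PI / 2 - e)) by lra.
  exists (mkposreal _ Hd). simpl. intros y Hy.
  pose proof (asin_bound y).
  assert (PI / 2 - e < asin y).
  { apply Rnot_le_lt. intros Hle.
    assert (sin (asin y) <= sin (PI / 2 - e)) by (apply sin_incr_1; lra).
    rewrite sin_asin in *; lra. }
  apply Rabs_def1; lra.
Qed.

Lemma filterlim_asin_1 {F : (R -> Prop) -> Prop} {FF : Filter F} (h : R -> R) :
  filterlim h F (locally 1) -> F (fun x => h x < 1) ->
  filterlim (fun x => asin (h x)) F (locally (PI / 2)).
Proof.
  intros Hl Hh. apply filterlim_locally. intros eps.
  destruct (asin_near_1 eps) as [d Hd].
  pose proof (proj1 (filterlim_locally h 1) Hl d) as H1.
  apply filter_imp with (2 := filter_and _ _ Hh H1). intros x [Hx1 Hx2].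
  change (Rabs (h x - 1) < d) in Hx2. apply Rabs_def2 in Hx2.
  apply Hd. lra.
Qed.

Lemma filterlim_asin_m1 {F : (R -> Prop) -> Prop} {FF : Filter F} (h : R -> R) :
  filterlim h F (locally (-1)) -> F (fun x => -1 < h x) ->
  filterlim (fun x => asin (h x)) F (locally (- (PI / 2))).
Proof.
  intros Hl Hh. apply filterlim_ext with (fun x => - asin (- h x)).
  { intros x. rewrite asin_opp. ring. }
  apply filterlim_comp with (locally (PI / 2)); [|apply (filterlim_opp (V := R_NormedModule))].
  apply (filterlim_asin_1 (fun x => - h x)).
  - replace 1 with (- -1) by ring.
    apply filterlim_comp with (1 := Hl), (filterlim_opp (V := R_NormedModule)).
  - apply filter_imp with (2 := Hh). intros; lra.
Qed.

Lemma sin_scal_range (rho rho1 t : R) :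
  0 < rho < rho1 -> - rho1 < rho * sin t < rho1.
Proof. intros H. pose proof (SIN_bound t). split; nra. Qed.

Definition half_period (g : R -> R) (a b rho : R) : R :=
  RInt (fun t => speed g a b (rho * sin t)) (- (PI / 2)) (PI / 2).

Lemma continuous_scal_sin (rho t : R) : continuous (fun s => rho * sin s) t.
Proof. apply (continuous_scal_r rho sin), continuous_sin. Qed.

Lemma continuous_speed_sin (g : R -> R) (a b rho t : R) :
  well g a b -> 0 < rho < radius g a ->
  continuous (fun s => speed g a b (rho * sin s)) t.
Proof.
  intros W Hr. apply (continuous_comp (fun s => rho * sin s) (speed g a b)).
  - apply continuous_scal_sin.
  - apply continuous_speed; auto. now apply sin_scal_range.
Qed.

(* Substituting [amplitude g x = rho * sin t] turns [c - G] into
   [rho^2 cos^2 t / 2] and makes the integral proper. *)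
Lemma is_RInt_gen_period (g : R -> R) (a b rho : R) :
  well g a b -> 0 < rho < radius g a ->
  is_RInt_gen (fun x => 1 / sqrt (rho ^ 2 / 2 - potential g x))
    (at_right (position g a b (- rho))) (at_left (position g a b rho))
    (sqrt 2 * half_period g a b rho).
Proof.
  intros W Hr.
  assert (Hp1 : - radius g a < rho < radius g a) by lra.
  assert (Hp2 : - radius g a < - rho < radius g a) by lra.
  destruct (position_spec g a b rho W Hp1) as [P1 E1].
  destruct (position_spec g a b (- rho) W Hp2) as [P2 E2].
  pose proof (position_sign g a b rho W Hp1 ltac:(lra)) as S1.
  pose proof (position_sign g a b (- rho) W Hp2 ltac:(lra)) as S2.
  set (a' := position g a b (- rho)) in *. set (b' := position g a b rho) in *.
  assert (Hab : a' < b') by nra.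
  set (f := fun t => speed g a b (rho * sin t)).
  assert (Cf : forall t, continuous f t) by (intros t; now apply continuous_speed_sin).
  assert (If : forall s t, ex_RInt f s t).
  { intros s t. apply (ex_RInt_continuous (V := R_CompleteNormedModule)). auto. }
  set (Q := fun t => RInt f 0 t).
  assert (DQ : forall t, is_derive Q t (f t)).
  { intros t. apply (is_derive_RInt (V := R_NormedModule) f Q 0); auto.
    apply filter_forall. intros s.
    apply (RInt_correct (V := R_CompleteNormedModule)), If. }
  assert (Hin : forall x, a' < x < b' -> -1 < amplitude g x / rho < 1).
  { intros x Hx.
    pose proof (amplitude_increasing g a b a' x W ltac:(lra) ltac:(lra) ltac:(lra)).
    pose proof (amplitude_increasing g a b x b' W ltac:(lra) ltac:(lra) ltac:(lra)).
    split; [apply Rlt_div_r|apply Rlt_div_l]; lra. }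
  (* The substitution takes the form of an antiderivative on the open interval; the improper
     integral is then the difference of the limits of [P] at the two turning points. *)
  set (P := fun x => sqrt 2 * Q (asin (amplitude g x / rho))).
  assert (Hgap : forall x, a' < x < b' -> 0 < rho ^ 2 / 2 - potential g x).
  { intros x Hx. pose proof (Hin x Hx) as [H1 H2].
    apply Rlt_div_r in H1; [|lra]. apply Rlt_div_l in H2; [|lra].
    pose proof (amplitude_sqr g a b x W ltac:(lra)). nra. }
  assert (DP : forall x, a' < x < b' ->
            is_derive P x (1 / sqrt (rho ^ 2 / 2 - potential g x))).
  { intros x Hx. pose proof (Hin x Hx) as Hx1. pose proof (Hgap x Hx) as Hg.
    assert (Hx2 : a < x < b) by lra.
    eapply is_derive_eq.
    - apply is_derive_scal.
      apply (is_derive_comp Q (fun y => asin (amplitude g y / rho))); [apply DQ|].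
      apply (is_derive_comp asin (fun y => amplitude g y / rho)).
      + apply is_derive_asin, Hx1.
      + apply is_derive_ext with (fun y => scal (/ rho) (amplitude g y)).
        { intros t. apply Rmult_comm. }
        apply is_derive_scal, (is_derive_amplitude _ _ _ _ W Hx2).
    - unfold scal; simpl; unfold mult; simpl. real_eq. unfold f.
      change (rho * (rho * 1)) with (rho ^ 2).
      rewrite sin_asin by lra.
      replace (rho * (amplitude g x / rho)) with (amplitude g x) by (field; lra).
      unfold speed. rewrite (position_amplitude g a b x W Hx2).
      pose proof (stretch_pos _ _ _ _ W Hx2).
      pose proof (amplitude_sqr g a b x W ltac:(lra)) as Eu.
      (* This factorization exposes the root of c - G: the factor rho / sqrt 2 that remains cancels
         against the factors sqrt 2 of [P] and 1/rho of the inner derivative. *)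
      replace (1 - (amplitude g x / rho)²)
        with ((sqrt 2 / rho) ^ 2 * (rho ^ 2 / 2 - potential g x)).
      2: { replace ((sqrt 2 / rho) ^ 2) with (sqrt 2 ^ 2 / rho ^ 2) by (field; lra).
           rewrite pow2_sqrt by lra. unfold Rsqr. replace (potential g x) with (amplitude g x ^ 2 / 2) by lra.
           field. lra. }
      assert (H2 : 0 < sqrt 2) by (apply sqrt_lt_R0; lra).
      rewrite sqrt_mult, sqrt_pow2; try lra.
      + pose proof (sqrt_lt_R0 _ Hg). field. repeat split; lra.
      + apply Rlt_le, Rdiv_lt_0_compat; lra.
      + apply pow2_ge_0. }
  replace (sqrt 2 * half_period g a b rho)
    with (sqrt 2 * Q (PI / 2) - sqrt 2 * Q (- (PI / 2))).
  2: { unfold Q. change (half_period g a b rho) with (RInt f (- (PI / 2)) (PI / 2)).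
       rewrite <- (RInt_Chasles f (- (PI / 2)) 0 (PI / 2)) by apply If.
       rewrite <- (opp_RInt_swap f 0 (- (PI / 2))) by apply If.
       unfold plus, opp; simpl. ring. }
  assert (CQ : forall t, continuous (fun s => sqrt 2 * Q s) t).
  { intros t. apply (continuous_scal_r (sqrt 2) Q).
    apply (is_derive_continuous _ _ _ (DQ t)). }
  assert (CA : forall x, a <= x <= b -> continuous (fun y => amplitude g y / rho) x).
  { intros x Hx. apply (continuous_mult (amplitude g) (fun _ => / rho)).
    - now apply continuous_amplitude with a b.
    - apply continuous_const. }
  assert (Fa : at_right a' (fun x => a' < x < b')).
  { apply filter_imp with (2 := locally_between (a' - 1) b' a' ltac:(lra)).
    intros x Hx Hx'. lra. }
  assert (Fb : at_left b' (fun x => a' < x < b')).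
  { apply filter_imp with (2 := locally_between a' (b' + 1) b' ltac:(lra)).
    intros x Hx Hx'. lra. }
  assert (Fab : forall Pr : R -> Prop, (forall x, a' < x < b' -> Pr x) ->
            filter_prod (at_right a') (at_left b')
              (fun ab => forall x, Rmin (fst ab) (snd ab) <= x <= Rmax (fst ab) (snd ab) -> Pr x)).
  { intros Pr HPr. apply Filter_prod with (1 := Fa) (2 := Fb).
    intros x y Hx Hy z Hz. simpl in Hz. apply HPr. revert Hz.
    unfold Rmin, Rmax. destruct Rle_dec; lra. }
  apply is_RInt_gen_ext with (Derive P).
  { eapply filter_imp; [|apply (Fab (fun x => Derive P x = 1 / sqrt (rho ^ 2 / 2 - potential g x)))].
    - intros [u v] H x Hx. apply H. lra.
    - intros x Hx. now apply is_derive_unique, DP. }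
  apply is_RInt_gen_Derive.
  - apply Fab. intros x Hx. eexists. now apply DP.
  - apply Fab. intros x Hx.
    apply continuous_ext_loc with (fun x => 1 / sqrt (rho ^ 2 / 2 - potential g x)).
    + apply filter_imp with (2 := locally_between _ _ _ Hx).
      intros y Hy. symmetry. now apply is_derive_unique, DP.
    + pose proof (Hgap x Hx) as Hg.
      apply (continuous_mult (fun _ => 1)); [apply continuous_const|].
      apply (continuous_comp (fun y => sqrt (rho ^ 2 / 2 - potential g y)) Rinv).
      * apply (continuous_comp (fun y => rho ^ 2 / 2 - potential g y) sqrt); [|apply continuous_sqrt].
        apply (continuous_minus (V := R_NormedModule) (fun _ => rho ^ 2 / 2)).
        -- apply continuous_const.
        -- eapply is_derive_continuous, (well_potential _ _ _ W). lra.
      * apply continuous_Rinv. pose proof (sqrt_lt_R0 _ Hg). lra.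
  - apply filterlim_comp with (2 := CQ (- (PI / 2))).
    apply (filterlim_asin_m1 (fun x => amplitude g x / rho)).
    + replace (-1) with (amplitude g a' / rho) by (rewrite E2; field; lra).
      exact (filterlim_filter_le_1 _ (filter_le_within (F := locally a') (fun u => a' < u))
               (CA a' ltac:(lra))).
    + apply filter_imp with (2 := Fa). intros x Hx. now apply Hin.
  - apply filterlim_comp with (2 := CQ (PI / 2)).
    apply (filterlim_asin_1 (fun x => amplitude g x / rho)).
    + replace 1 with (amplitude g b' / rho) by (rewrite E1; field; lra).
      exact (filterlim_filter_le_1 _ (filter_le_within (F := locally b') (fun u => u < b'))
               (CA b' ltac:(lra))).
    + apply filter_imp with (2 := Fb). intros x Hx. now apply Hin.
Qed.

Lemma period_half_period (g : R -> R) (l r : Rbar) (a b rho : R) :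
  well g a b -> (forall x, a <= x <= b -> in_dom l r x) ->
  0 < rho < radius g a ->
  period g l r (rho ^ 2 / 2) = 2 * half_period g a b rho.
Proof.
  intros W D Hr. pose proof (turning_points_position g l r a b rho W D Hr) as TP.
  assert (E : sqrt 2 * RInt_gen (fun x => 1 / sqrt (rho ^ 2 / 2 - potential g x))
     (at_right (position g a b (- rho))) (at_left (position g a b rho))
     = 2 * half_period g a b rho).
  { rewrite (is_RInt_gen_unique _ _ (is_RInt_gen_period g a b rho W Hr)).
    rewrite <- Rmult_assoc, sqrt_sqrt; [reflexivity|lra]. }
  unfold period. apply (iota_unique (V := R_CompleteNormedModule)).
  - intros t (a1 & b1 & T1 & ->).
    destruct (turning_points_unique _ _ _ _ _ _ _ _ T1 TP) as [-> ->]. exact E.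
  - exists (position g a b (- rho)), (position g a b rho). split; [exact TP|].
    symmetry. exact E.
Qed.

(** * The derivative of the period *)

Definition half_period_slope (g : R -> R) (a b rho : R) : R :=
  RInt (fun t => sin t * bend g a b (rho * sin t)) (- (PI / 2)) (PI / 2).

Lemma is_derive_half_period (g : R -> R) (a b rho : R) :
  well g a b -> 0 < rho < radius g a ->
  is_derive (half_period g a b) rho (half_period_slope g a b rho).
Proof.
  intros W Hr.
  assert (D : forall r t, 0 < r < radius g a ->
            is_derive (fun s => speed g a b (s * sin t)) r
              (sin t * bend g a b (r * sin t))).
  { intros r t H.
    apply (is_derive_comp (speed g a b) (fun s => s * sin t)).
    - apply is_derive_speed; auto. now apply sin_scal_range.
    - auto_derive; [easy|]. apply Rmult_1_l. }
  eapply is_derive_eq.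
  - apply (is_derive_RInt_param (fun r t => speed g a b (r * sin t))).
    + apply filter_imp with (2 := locally_between _ _ _ Hr).
      intros r H t _. eexists. now apply D.
    + intros t _.
      (* The derivative in the parameter has this closed form only for r in ]0, radius[, so the
         replacement is made locally around [rho]. *)
      apply continuity_2d_pt_ext_loc with (fun r t => sin t * bend g a b (r * sin t)).
      { destruct (locally_between _ _ _ Hr) as [d Hd]. exists d.
        intros u v Hu _. symmetry. apply is_derive_unique, D, (Hd u Hu). }
      assert (Cs : continuity_2d_pt (fun _ v => sin v) rho t).
      { apply (continuity_1d_2d_pt_comp sin (fun _ v => v)).
        - apply continuity_sin.
        - apply continuity_2d_pt_id2. }
      apply (continuity_2d_pt_mult (fun _ v => sin v)); [exact Cs|].
      apply (continuity_1d_2d_pt_comp (bend g a b) (fun u v => u * sin v)).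
      * apply continuity_pt_filterlim, continuous_bend; auto.
        now apply sin_scal_range.
      * apply (continuity_2d_pt_mult (fun u _ => u) (fun _ v => sin v)); [|exact Cs].
        apply continuity_2d_pt_id1.
    + apply filter_imp with (2 := locally_between _ _ _ Hr). intros r H.
      apply (ex_RInt_continuous (V := R_CompleteNormedModule)).
      intros t _. now apply continuous_speed_sin.
  - apply RInt_ext. intros t _. now apply is_derive_unique, D.
Qed.

Lemma bend_calF (g : R -> R) (a b v : R) :
  well g a b -> - radius g a < v < radius g a -> v <> 0 ->
  bend g a b v = calF g (position g a b v) / g (position g a b v) ^ 3
                 + (alpha g + beta g * v ^ 2 / 2).
Proof.
  intros W Hv Hv0. destruct (position_spec g a b v W Hv) as [Hp Ep].
  pose proof (position_sign g a b v W Hv Hv0) as Hs.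
  unfold bend, shear, calF, alpha, beta. rewrite (potential_position g a b v W Hv).
  destruct Req_EM_T as [E|Hx]; [rewrite E in Hs; lra|].
  pose proof (well_force_neq_0 _ _ _ _ W Hp Hx). field. auto.
Qed.

Lemma bend_0 (g : R -> R) (a b : R) : well g a b -> bend g a b 0 = alpha g.
Proof.
  intros W. unfold bend, shear. rewrite position_0; auto. now destruct Req_EM_T.
Qed.

Lemma continuous_excess (g : R -> R) (a b rho t : R) :
  well g a b -> 0 < rho < radius g a ->
  continuous (fun s => sin s * (bend g a b (rho * sin s)
                - (alpha g + beta g * (rho * sin s) ^ 2 / 2))) t.
Proof.
  intros W Hr.
  apply (continuous_mult sin); [apply continuous_sin|].
  apply (continuous_minus (V := R_NormedModule) (fun s => bend g a b (rho * sin s))).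
  - apply (continuous_comp (fun s => rho * sin s) (bend g a b)).
    + apply continuous_scal_sin.
    + apply continuous_bend; auto. now apply sin_scal_range.
  - apply (ex_derive_continuous (V := R_NormedModule)). now auto_derive.
Qed.

(* The even summand [alpha + beta v^2 / 2] of [bend] contributes an odd integrand,
   hence nothing. *)
Lemma half_period_slope_excess (g : R -> R) (a b rho : R) :
  well g a b -> 0 < rho < radius g a ->
  half_period_slope g a b rho =
  RInt (fun t => sin t * (bend g a b (rho * sin t)
          - (alpha g + beta g * (rho * sin t) ^ 2 / 2))) (- (PI / 2)) (PI / 2).
Proof.
  intros W Hr. unfold half_period_slope.
  set (k := fun t => sin t * (bend g a b (rho * sin t)
          - (alpha g + beta g * (rho * sin t) ^ 2 / 2))).
  set (e := fun t => sin t * (alpha g + beta g * (rho * sin t) ^ 2 / 2)).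
  (* An antiderivative of [e], from sin^3 = sin - sin cos^2. Each of its terms contains a factor
     cos, so it vanishes at both ends. *)
  set (E := fun t => - alpha g * cos t
               + beta g * rho ^ 2 / 2 * (cos t ^ 3 / 3 - cos t)).
  assert (Ce : forall t, continuous e t).
  { intros t. apply (ex_derive_continuous (V := R_NormedModule)).
    unfold e. now auto_derive. }
  assert (Ie : is_RInt e (- (PI / 2)) (PI / 2) 0).
  { replace 0 with (minus (E (PI / 2)) (E (- (PI / 2)))).
    - apply (is_RInt_derive (V := R_CompleteNormedModule) E e); [|auto].
      intros t _. unfold E, e. auto_derive; [easy|].
      transitivity (alpha g * sin t
        + beta g * rho ^ 2 / 2 * (sin t - sin t * (cos t)²)); [unfold Rsqr; simpl; field|].
      rewrite cos2. unfold Rsqr. field.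
    - unfold E, minus, plus, opp; simpl. rewrite cos_neg, cos_PI2. ring. }
  rewrite (RInt_ext _ (fun t => plus (k t) (e t))).
  2: { intros t _. unfold k, e, plus; simpl. ring. }
  rewrite (RInt_plus (V := R_CompleteNormedModule)).
  - rewrite (is_RInt_unique e _ _ _ Ie). apply Rplus_0_r.
  - apply (ex_RInt_continuous (V := R_CompleteNormedModule)). intros t _.
    now apply continuous_excess.
  - eexists; exact Ie.
Qed.

(** At x = X(rho sin t) the force has the sign of sin t, so sin t * calF/g^3 = (sin t * g) *
    calF/g^4 has the sign of calF on both halves of the interval. The factor [sg], later 1 or -1,
    treats both signs of calF at once. *)
Lemma half_period_slope_sign (g : R -> R) (a b rho sg : R) :
  well g a b -> 0 < rho < radius g a ->
  (forall x, a < x < b -> x <> 0 -> 0 < sg * calF g x) ->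
  0 < sg * half_period_slope g a b rho.
Proof.
  intros W Hr HF. rewrite half_period_slope_excess by assumption.
  set (k := fun t => sin t * (bend g a b (rho * sin t)
          - (alpha g + beta g * (rho * sin t) ^ 2 / 2))).
  assert (Ck : forall t, continuous (fun s => sg * k s) t).
  { intros t. apply (continuous_scal_r sg k). now apply continuous_excess. }
  pose proof PI_RGT_0 as HPI.
  assert (Hk : forall t, sin t <> 0 -> 0 < sg * k t).
  { intros t Ht. unfold k.
    pose proof (sin_scal_range rho (radius g a) t Hr) as Hv.
    assert (Hv0 : rho * sin t <> 0) by (apply Rmult_integral_contrapositive_currified; lra).
    rewrite (bend_calF g a b _ W Hv Hv0).
    destruct (position_spec g a b _ W Hv) as [Hp _].
    pose proof (position_sign g a b _ W Hv Hv0) as Hs.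
    set (x := position g a b (rho * sin t)) in *.
    assert (Hx0 : x <> 0) by (intros E; rewrite E in Hs; lra).
    pose proof (HF x Hp Hx0) as HFx.
    pose proof (well_sign _ _ _ W x Hp Hx0) as Hg.
    pose proof (well_force_neq_0 _ _ _ _ W Hp Hx0) as Hg0.
    assert (H1 : 0 < sin t * g x).
    { assert (H2 : 0 < (rho * sin t * x) * (x * g x)) by (now apply Rmult_lt_0_compat).
      assert (H3 : 0 < x ^ 2) by now apply pow2_gt_0.
      replace (rho * sin t * x * (x * g x)) with ((rho * x ^ 2) * (sin t * g x)) in H2 by ring.
      assert (H4 : 0 < rho * x ^ 2) by (apply Rmult_lt_0_compat; lra). nra. }
    assert (H4 : 0 < (g x ^ 2) ^ 2) by now apply pow2_gt_0, pow_nonzero.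
    replace (sg * _) with ((sin t * g x) * (sg * calF g x) * / (g x ^ 2) ^ 2)
      by (field; auto).
    apply Rmult_lt_0_compat; [now apply Rmult_lt_0_compat|now apply Rinv_0_lt_compat]. }
  assert (Ik : forall s t, ex_RInt k s t).
  { intros s t. apply (ex_RInt_continuous (V := R_CompleteNormedModule)).
    intros z _. now apply continuous_excess. }
  (* The integrand vanishes at t = 0 and is strictly signed on either side, so strict positivity is
     obtained on each half separately. *)
  rewrite <- (RInt_Chasles k (- (PI / 2)) 0 (PI / 2)) by apply Ik.
  unfold plus; simpl. rewrite Rmult_plus_distr_l.
  rewrite <- !(RInt_scal (V := R_CompleteNormedModule) k _ _ sg) by apply Ik.
  apply Rplus_lt_0_compat.
  - apply (RInt_gt_0 (fun s => sg * k s)); auto; [lra|].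
    intros t Ht. apply Hk. pose proof (sin_lt_0_var t ltac:(lra) ltac:(lra)). lra.
  - apply (RInt_gt_0 (fun s => sg * k s)); auto; [lra|].
    intros t Ht. apply Hk. pose proof (sin_gt_0 t ltac:(lra) ltac:(lra)). lra.
Qed.

Lemma is_derive_period (g : R -> R) (l r : Rbar) (a b c : R) :
  well g a b -> (forall x, a <= x <= b -> in_dom l r x) ->
  0 < c < potential g a ->
  is_derive (period g l r) c
    (2 / sqrt (2 * c) * half_period_slope g a b (sqrt (2 * c))).
Proof.
  intros W D Hc.
  assert (Hs : forall e, 0 < e < potential g a -> 0 < sqrt (2 * e) < radius g a).
  { intros e He. split; [apply sqrt_lt_R0|apply sqrt_lt_1]; lra. }
  apply is_derive_ext_loc with (fun e => 2 * half_period g a b (sqrt (2 * e))).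
  - apply filter_imp with (2 := locally_between _ _ _ Hc). intros e He.
    rewrite <- (period_half_period g l r a b _ W D (Hs e He)).
    f_equal. rewrite pow2_sqrt; [field|]; lra.
  - pose proof (Hs c Hc). eapply is_derive_eq.
    + apply is_derive_scal.
      apply (is_derive_comp (half_period g a b) (fun e => sqrt (2 * e))).
      * apply is_derive_half_period; auto.
      * auto_derive; [lra|]. reflexivity.
    + unfold scal; simpl; unfold mult; simpl. real_eq. field. lra.
Qed.

(** * Reaching energies and positions by actual wells *)

Lemma energy_sup_turning_points (g : R -> R) (l r : Rbar) (c : R) :
  Rbar_lt c (energy_sup g l r) ->
  exists c' a b, c < c' /\ turning_points g l r c' a b.
Proof.
  intros H. apply NNPP. intros Hn.
  apply (Rbar_lt_not_le _ _ H), Lub_Rbar_correct.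
  intros c' (a & b & T). simpl. apply Rnot_lt_le. intros Hc. eauto 6.
Qed.

Lemma right_end_turning_points (g : R -> R) (l r : Rbar) (x : R) :
  Rbar_lt x (right_end g l r) ->
  exists c a b, x < b /\ turning_points g l r c a b.
Proof.
  intros H. apply NNPP. intros Hn.
  apply (Rbar_lt_not_le _ _ H), Lub_Rbar_correct.
  intros b (c & a & T). simpl. apply Rnot_lt_le. intros Hc. eauto 6.
Qed.

Lemma left_end_turning_points (g : R -> R) (l r : Rbar) (x : R) :
  Rbar_lt (left_end g l r) x ->
  exists c a b, a < x /\ turning_points g l r c a b.
Proof.
  intros H. apply NNPP. intros Hn.
  apply (Rbar_lt_not_le _ _ H), Glb_Rbar_correct.
  intros a (c & b & T). simpl. apply Rnot_lt_le. intros Hc. eauto 6.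
Qed.

Lemma turning_points_ends (g : R -> R) (l r : Rbar) (c a b x : R) :
  turning_points g l r c a b -> a < x < b ->
  Rbar_lt (left_end g l r) x /\ Rbar_lt x (right_end g l r).
Proof.
  intros T Hx. split.
  - apply Rbar_le_lt_trans with a; [|exact (proj1 Hx)].
    apply Glb_Rbar_correct. eauto.
  - apply Rbar_lt_le_trans with b; [exact (proj2 Hx)|].
    apply Lub_Rbar_correct. eauto.
Qed.

(** The two ends are bounds of separate families, but one well suffices: a negative x lies in every
    well whose left end is below x, because the right end is positive, and symmetrically for a
    positive x. *)
Lemma ends_turning_points (g : R -> R) (l r : Rbar) (x : R) :
  Rbar_lt (left_end g l r) x -> Rbar_lt x (right_end g l r) -> x <> 0 ->
  exists c a b, a < x < b /\ turning_points g l r c a b.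
Proof.
  intros Hl Hr Hx0. destruct (Rdichotomy _ _ Hx0) as [Hn|Hp].
  - destruct (left_end_turning_points _ _ _ _ Hl) as (c & a & b & Hx & T).
    exists c, a, b. split; [|exact T]. destruct T as (_ & _ & T & _). lra.
  - destruct (right_end_turning_points _ _ _ _ Hr) as (c & a & b & Hx & T).
    exists c, a, b. split; [|exact T]. destruct T as (_ & _ & T & _). lra.
Qed.

Lemma Derive_period_sign (g : R -> R) (l r : Rbar) (sg c : R) :
  in_dom l r 0 -> (forall x, in_dom l r x -> analytic_at g x) ->
  g 0 = 0 -> Derive g 0 = 1 ->
  (forall x : R, Rbar_lt (left_end g l r) x -> Rbar_lt x (right_end g l r) ->
     x <> 0 -> 0 < sg * calF g x) ->
  0 < c -> Rbar_lt c (energy_sup g l r) ->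
  ex_derive (period g l r) c /\ 0 < sg * Derive (period g l r) c.
Proof.
  intros D0 An g0 dg0 HF Hc Hsup.
  (* An energy c1 strictly above c is realized; its well contains a whole neighbourhood of the orbit
     of energy c. *)
  destruct (energy_sup_turning_points _ _ _ _ Hsup) as (c1 & a & b & Hc1 & T).
  pose proof (turning_points_well g l r c1 a b D0 An g0 dg0 T) as W.
  assert (D : forall x, a <= x <= b -> in_dom l r x).
  { destruct T as (Da & Db & _). intros x. now apply in_dom_between. }
  assert (Ga : potential g a = c1) by (destruct T as (_ & _ & _ & E & _); exact E).
  assert (Hc2 : 0 < c < potential g a) by lra.
  pose proof (is_derive_period g l r a b c W D Hc2) as DP.
  split; [eexists; exact DP|].
  rewrite (is_derive_unique _ _ _ DP).
  assert (Hs : 0 < sqrt (2 * c) < radius g a).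
  { split; [apply sqrt_lt_R0|apply sqrt_lt_1]; lra. }
  replace (sg * _) with (2 / sqrt (2 * c) * (sg * half_period_slope g a b (sqrt (2 * c))))
    by ring.
  apply Rmult_lt_0_compat.
  - apply Rdiv_lt_0_compat; lra.
  - apply half_period_slope_sign; auto. intros x Hx.
    destruct (turning_points_ends _ _ _ _ _ _ _ T Hx). auto.
Qed.

(** * The differential equation for G/g^2 *)

Lemma is_derive_potential_ratio (g : R -> R) (a b x : R) :
  well g a b -> a < x < b -> x <> 0 ->
  is_derive (fun s => potential g s / g s ^ 2) x
    ((g x ^ 2 - 2 * potential g x * Derive g x) / g x ^ 3).
Proof.
  intros W Hx Hx0. pose proof (well_force_neq_0 _ _ _ _ W Hx Hx0) as Hg.
  eapply is_derive_eq.
  - apply is_derive_div.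
    + apply (well_potential _ _ _ W). lra.
    + apply is_derive_pow, (well_derive _ _ _ W). lra.
    + now apply pow_nonzero.
  - simpl. field. auto.
Qed.

(** Away from 0 the derivative of G/g^2 is X'' seen as a function of position, and calF is g^3 times
    the difference between it and alpha + beta G; the factor g^3 does not vanish. *)
Lemma calF_0_iff (g : R -> R) (a b x : R) :
  well g a b -> a < x < b -> x <> 0 ->
  calF g x = 0 <->
  is_derive (fun s => potential g s / g s ^ 2) x (alpha g + beta g * potential g x).
Proof.
  intros W Hx Hx0. pose proof (well_force_neq_0 _ _ _ _ W Hx Hx0) as Hg.
  pose proof (is_derive_potential_ratio g a b x W Hx Hx0) as DR.
  assert (E : calF g x = g x ^ 3 *
            ((g x ^ 2 - 2 * potential g x * Derive g x) / g x ^ 3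
             - (alpha g + beta g * potential g x))).
  { unfold calF, alpha, beta. field. auto. }
  split.
  - intros H0. apply is_derive_eq with (1 := DR).
    rewrite E in H0. apply Rmult_integral in H0.
    destruct H0 as [H0|H0]; [|lra]. now apply (pow_nonzero _ 3) in Hg.
  - intros DR'. rewrite E, <- (is_derive_unique _ _ _ DR), (is_derive_unique _ _ _ DR').
    ring.
Qed.

(** * Isochronous orbits *)

(** At v = 0 the quotient calF/g^3 says nothing; there the completed value of [shear] is already
    [alpha]. *)
Lemma bend_isochronous (g : R -> R) (a b v : R) :
  well g a b -> (forall x, a < x < b -> calF g x = 0) ->
  - radius g a < v < radius g a ->
  bend g a b v = alpha g + beta g * v ^ 2 / 2.
Proof.
  intros W HF Hv. destruct (Req_dec v 0) as [->|Hv0].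
  - rewrite (bend_0 g a b W). field.
  - rewrite (bend_calF g a b v W Hv Hv0), HF by now apply position_spec.
    unfold Rdiv at 1. ring.
Qed.

Lemma speed_isochronous (g : R -> R) (a b v : R) :
  well g a b -> (forall x, a < x < b -> calF g x = 0) ->
  - radius g a < v < radius g a ->
  speed g a b v = 1 + alpha g * v + beta g * v ^ 3 / 6.
Proof.
  intros W HF Hv. pose proof (radius_pos _ _ _ W).
  set (f := fun w => speed g a b w - (1 + alpha g * w + beta g * w ^ 3 / 6)).
  assert (Hin : forall w, Rmin 0 v <= w <= Rmax 0 v -> - radius g a < w < radius g a).
  { intros w. unfold Rmin, Rmax. destruct Rle_dec; lra. }
  assert (Df : forall w, - radius g a < w < radius g a -> is_derive f w 0).
  { intros w Hw. eapply is_derive_eq.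
    - apply (is_derive_minus (V := R_NormedModule) (speed g a b)).
      + now apply is_derive_speed.
      + auto_derive; [easy|reflexivity].
    - rewrite (bend_isochronous g a b w W HF Hw).
      unfold minus, plus, opp; simpl. field. }
  destruct (MVT_gen f 0 v (fun _ => 0)) as [w [_ E]].
  - intros w Hw. apply Df, Hin. lra.
  - intros w Hw. apply continuity_pt_filterlim.
    eapply is_derive_continuous, Df, Hin, Hw.
  - assert (E0 : speed g a b 0 = 1) by (unfold speed; now rewrite position_0, stretch_0).
    unfold f in E. rewrite E0 in E. lra.
Qed.

(* The time needed to reach the phase [s] on the orbit
   [amplitude g x = rho * sin s], [y = rho * cos s]. *)
Definition orbit_time (g : R -> R) (rho s : R) : R :=
  s - alpha g * rho * cos s + beta g * rho ^ 3 / 6 * (cos s ^ 3 / 3 - cos s).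

Definition orbit_phase (g : R -> R) (rho t : R) : R :=
  epsilon (inhabits 0) (fun s => orbit_time g rho s = t).

Lemma is_derive_orbit_time (g : R -> R) (a b rho s : R) :
  well g a b -> (forall x, a < x < b -> calF g x = 0) ->
  0 < rho < radius g a ->
  is_derive (orbit_time g rho) s (speed g a b (rho * sin s)).
Proof.
  intros W HF Hr. rewrite (speed_isochronous g a b _ W HF)
    by now apply sin_scal_range.
  unfold orbit_time. auto_derive; [easy|].
  transitivity (1 + alpha g * rho * sin s
    + beta g * rho ^ 3 / 6 * (sin s - sin s * (cos s)²)); [unfold Rsqr; simpl; field|].
  rewrite cos2. unfold Rsqr. field.
Qed.

Lemma orbit_time_increasing (g : R -> R) (a b rho s t : R) :
  well g a b -> (forall x, a < x < b -> calF g x = 0) ->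
  0 < rho < radius g a ->
  s < t -> orbit_time g rho s < orbit_time g rho t.
Proof.
  intros W HF Hr Hst.
  apply (incr_function (orbit_time g rho) m_infty p_infty
           (fun z => speed g a b (rho * sin z))); simpl; auto.
  - intros z _ _. now apply is_derive_orbit_time.
  - intros z _ _. apply speed_pos; auto. now apply sin_scal_range.
Qed.

(** The source of isochrony: apart from the summand s, all terms are periodic in s, so a full turn
    takes 2 PI whatever [rho] is. *)
Lemma orbit_time_2PI (g : R -> R) (rho s : R) :
  orbit_time g rho (s + 2 * PI) = orbit_time g rho s + 2 * PI.
Proof. unfold orbit_time. rewrite cos_plus, cos_2PI, sin_2PI. field. Qed.

Lemma orbit_time_surjective (g : R -> R) (a b rho t : R) :
  well g a b -> (forall x, a < x < b -> calF g x = 0) ->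
  0 < rho < radius g a ->
  exists s, orbit_time g rho s = t.
Proof.
  intros W HF Hr.
  (* [M] bounds the periodic part of [orbit_time], using |cos| <= 1 and the crude bound |cos^3/3 -
     cos| <= 2; the intermediate value theorem then applies between t - M - 1 and t + M + 1. *)
  set (M := Rabs (alpha g * rho) + Rabs (beta g * rho ^ 3 / 6) * 2).
  assert (HM : forall s, Rabs (orbit_time g rho s - s) <= M).
  { intros s. unfold orbit_time, M.
    replace (s - alpha g * rho * cos s + beta g * rho ^ 3 / 6 * (cos s ^ 3 / 3 - cos s) - s)
      with ((alpha g * rho) * (- cos s) + (beta g * rho ^ 3 / 6) * (cos s ^ 3 / 3 - cos s))
      by ring.
    eapply Rle_trans; [apply Rabs_triang|].
    pose proof (COS_bound s).
    rewrite !Rabs_mult. apply Rplus_le_compat.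
    - rewrite <- (Rmult_1_r (Rabs (alpha g) * _)) at 2.
      apply Rmult_le_compat_l.
      + apply Rmult_le_pos; apply Rabs_pos.
      + apply Rabs_le. lra.
    - apply Rmult_le_compat_l; [apply Rabs_pos|].
      apply Rabs_le. split; nra. }
  assert (HM0 : 0 <= M) by (eapply Rle_trans; [apply Rabs_pos|apply (HM 0)]).
  destruct (IVT_interv (fun s => orbit_time g rho s - t) (t - M - 1) (t + M + 1))
    as [s [_ Es]].
  - intros s _. apply continuity_pt_filterlim.
    apply (continuous_minus (V := R_NormedModule) (orbit_time g rho) (fun _ => t)).
    + eapply is_derive_continuous, is_derive_orbit_time; eauto.
    + apply continuous_const.
  - lra.
  - pose proof (HM (t - M - 1)) as H. apply Rabs_le_between in H. lra.
  - pose proof (HM (t + M + 1)) as H. apply Rabs_le_between in H. lra.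
  - exists s. lra.
Qed.

Lemma orbit_time_phase (g : R -> R) (a b rho t : R) :
  well g a b -> (forall x, a < x < b -> calF g x = 0) ->
  0 < rho < radius g a ->
  orbit_time g rho (orbit_phase g rho t) = t.
Proof.
  intros W HF Hr. apply (epsilon_spec (inhabits 0) (fun s => orbit_time g rho s = t)).
  now apply orbit_time_surjective with a b.
Qed.

Lemma orbit_phase_time (g : R -> R) (a b rho s : R) :
  well g a b -> (forall x, a < x < b -> calF g x = 0) ->
  0 < rho < radius g a ->
  orbit_phase g rho (orbit_time g rho s) = s.
Proof.
  intros W HF Hr. pose proof (orbit_time_phase g a b rho (orbit_time g rho s) W HF Hr) as E.
  destruct (Rtotal_order (orbit_phase g rho (orbit_time g rho s)) s) as [Hlt|[|Hlt]]; auto;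
    pose proof (orbit_time_increasing g a b rho _ _ W HF Hr Hlt); lra.
Qed.

Lemma is_derive_orbit_phase (g : R -> R) (a b rho t : R) :
  well g a b -> (forall x, a < x < b -> calF g x = 0) ->
  0 < rho < radius g a ->
  is_derive (orbit_phase g rho) t (/ speed g a b (rho * sin (orbit_phase g rho t))).
Proof.
  intros W HF Hr. apply (is_derive_right_inverse (orbit_time g rho)).
  - apply filter_forall. intros v. now apply orbit_time_phase with a b.
  - apply (continuous_right_inverse (orbit_time g rho) _ (fun _ => True) (fun _ => True)).
    + intros x y _ _. now apply orbit_time_increasing with a b.
    + apply open_true.
    + now apply filter_forall.
    + intros v _. split; [easy|]. now apply orbit_time_phase with a b.
  - now apply is_derive_orbit_time.
  - pose proof (speed_pos g a b _ W (sin_scal_range _ _ (orbit_phase g rho t) Hr)). lra.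
Qed.

Lemma orbit_phase_2PI (g : R -> R) (a b rho t : R) :
  well g a b -> (forall x, a < x < b -> calF g x = 0) ->
  0 < rho < radius g a ->
  orbit_phase g rho (t + 2 * PI) = orbit_phase g rho t + 2 * PI.
Proof.
  intros W HF Hr.
  rewrite <- (orbit_time_phase g a b rho t W HF Hr) at 1.
  rewrite <- orbit_time_2PI. now apply orbit_phase_time with a b.
Qed.

Lemma cos_lt_1 (d : R) : 0 < d < 2 * PI -> cos d < 1.
Proof.
  intros Hd. replace d with (2 * (d / 2)) by field. rewrite cos_2a_sin.
  assert (0 < sin (d / 2)) by (apply sin_gt_0; lra). nra.
Qed.

(** The phase [ph] satisfies ph' = 1/X'(rho sin ph), which makes x' equal to y by the chain rule.
    Shifting time by [orbit_time g rho s0] starts the orbit at the phase [s0], and the last clause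
    serves to bound x. *)
Lemma isochronous_orbit (g : R -> R) (l r : Rbar) (a b rho s0 : R) :
  well g a b -> (forall x, a <= x <= b -> in_dom l r x) ->
  (forall x, a < x < b -> calF g x = 0) ->
  0 < rho < radius g a ->
  exists x y, is_solution g l r x y /\
    x 0 = position g a b (rho * sin s0) /\ y 0 = rho * cos s0 /\
    is_minimal_period x y (2 * PI) /\
    forall t, exists s, x t = position g a b (rho * sin s).
Proof.
  intros W D HF Hr.
  set (ph := fun t => orbit_phase g rho (t + orbit_time g rho s0)).
  exists (fun t => position g a b (rho * sin (ph t))), (fun t => rho * cos (ph t)).
  assert (Hv : forall s, - radius g a < rho * sin s < radius g a).
  { intros s. now apply sin_scal_range. }
  assert (Dph : forall t, is_derive ph t (/ speed g a b (rho * sin (ph t)))).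
  { intros t. unfold ph. eapply is_derive_eq.
    - apply (is_derive_comp (orbit_phase g rho) (fun z => z + orbit_time g rho s0)).
      + apply (is_derive_orbit_phase g a b); auto.
      + auto_derive; [easy|reflexivity].
    - apply Rmult_1_l. }
  assert (Eph : forall t, ph (t + 2 * PI) = ph t + 2 * PI).
  { intros t. unfold ph. rewrite <- (orbit_phase_2PI g a b) by assumption. f_equal. ring. }
  assert (E0 : ph 0 = s0).
  { unfold ph. rewrite Rplus_0_l. now apply orbit_phase_time with a b. }
  split; [intros t; split; [|split]|split; [|split; [|split; [split; [|split]|]]]].
  - apply D. destruct (position_spec g a b _ W (Hv (ph t))). lra.
  - pose proof (speed_pos g a b _ W (Hv (ph t))). eapply is_derive_eq.
    + apply (is_derive_comp (position g a b) (fun z => rho * sin (ph z))).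
      * apply is_derive_position; auto.
      * apply is_derive_scal, (is_derive_comp sin ph); [|apply Dph].
        apply is_derive_Reals, derivable_pt_lim_sin.
    + fold (speed g a b (rho * sin (ph t))).
      unfold scal; simpl; unfold mult; simpl. real_eq. field. lra.
  - pose proof (speed_pos g a b _ W (Hv (ph t))) as Hsp.
    destruct (position_spec g a b _ W (Hv (ph t))) as [Hp Ep].
    pose proof (stretch_mult g a b _ W Hp) as Em. rewrite Ep in Em.
    fold (speed g a b (rho * sin (ph t))) in Em. eapply is_derive_eq.
    + apply is_derive_scal, (is_derive_comp cos ph); [|apply Dph].
      apply is_derive_Reals, derivable_pt_lim_cos.
    + unfold scal; simpl; unfold mult; simpl. real_eq.
      (* After multiplication by X' the equation y' = -g becomes X' g = u, which is
         [stretch_mult]. *)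
      apply Rmult_eq_reg_l with (speed g a b (rho * sin (ph t))); [|lra].
      transitivity (- (rho * sin (ph t))); [field; lra|rewrite <- Em at 1; ring].
  - now rewrite E0.
  - now rewrite E0.
  - pose proof PI_RGT_0. lra.
  - intros t. rewrite Eph, sin_plus, cos_plus, cos_2PI, sin_2PI.
    split; [do 2 f_equal|]; ring.
  (* A period S shorter than 2 PI would give phases at times 0 and S with the same sine and cosine,
     although they differ by a number strictly between 0 and 2 PI. *)
  - intros S HS HP. destruct (HP 0) as [Hx Hy]. rewrite Rplus_0_l in Hx, Hy.
    assert (Es : sin (ph S) = sin (ph 0)).
    { apply Rmult_eq_reg_l with rho; [|lra].
      destruct (position_spec g a b _ W (Hv (ph S))) as [_ <-].
      destruct (position_spec g a b _ W (Hv (ph 0))) as [_ <-]. now rewrite Hx. }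
    assert (Ec : cos (ph S) = cos (ph 0)) by (apply Rmult_eq_reg_l with rho; lra).
    assert (E1 : cos (ph S - ph 0) = 1).
    { rewrite cos_minus, Es, Ec. pose proof (sin2_cos2 (ph 0)). unfold Rsqr in *. lra. }
    assert (ET : forall t, orbit_time g rho (ph t) = t + orbit_time g rho s0).
    { intros t. now apply orbit_time_phase with a b. }
    apply Rnot_lt_le. intros Hlt.
    assert (H1 : ph 0 < ph S).
    { apply Rnot_le_lt. intros [Hle|Heq].
      - pose proof (orbit_time_increasing g a b rho _ _ W HF Hr Hle).
        rewrite !ET in *. lra.
      - pose proof (ET S) as E. rewrite Heq, ET in E. lra. }
    assert (H2 : ph S < ph 0 + 2 * PI).
    { rewrite <- Eph. apply Rnot_le_lt. intros [Hle|Heq].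
      - pose proof (orbit_time_increasing g a b rho _ _ W HF Hr Hle).
        rewrite !ET in *. lra.
      - pose proof (ET S) as E. rewrite <- Heq, ET in E. lra. }
    pose proof (cos_lt_1 (ph S - ph 0) ltac:(lra)). lra.
  - intros t. now exists (ph t).
Qed.

Lemma polar_coordinates (p q rho : R) :
  0 < rho -> p ^ 2 + q ^ 2 = rho ^ 2 ->
  exists s, p = rho * sin s /\ q = rho * cos s.
Proof.
  intros Hr E. set (z := p / rho).
  assert (Ep : p = rho * z) by (unfold z; field; lra).
  assert (Hz2 : z ^ 2 <= 1).
  { apply Rmult_le_reg_l with (rho ^ 2); [now apply pow_lt|].
    rewrite <- Rpow_mult_distr, <- Ep. pose proof (pow2_ge_0 q). lra. }
  assert (Hz : -1 <= z <= 1) by (split; nra).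
  assert (Hc : rho * sqrt (1 - z²) = Rabs q).
  { rewrite <- (sqrt_pow2 rho) at 1 by lra. rewrite <- sqrt_mult by (try apply pow2_ge_0; unfold Rsqr; nra).
    rewrite <- sqrt_Rsqr_abs. f_equal. rewrite Ep in E. unfold Rsqr. lra. }
  (* The angle [asin z] has a nonnegative cosine; for negative q it is reflected to PI - asin z,
     which keeps the sine and changes the sign of the cosine. *)
  destruct (Rle_dec 0 q) as [Hq|Hq].
  - exists (asin z). rewrite sin_asin, cos_asin, Hc, Rabs_pos_eq by lra. auto.
  - exists (PI - asin z). rewrite sin_minus, cos_minus, sin_PI, cos_PI, sin_asin by lra.
    rewrite cos_asin by lra. rewrite Rabs_left in Hc by lra. lra.
Qed.

Lemma isochronous_orbits_near_0 (g : R -> R) (l r : Rbar) (a b eps : R) :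
  well g a b -> (forall x, a <= x <= b -> in_dom l r x) ->
  (forall x, a < x < b -> calF g x = 0) -> 0 < eps ->
  exists delta, 0 < delta /\ forall p q, 0 < p ^ 2 + q ^ 2 < delta ^ 2 ->
    exists x y, is_solution g l r x y /\ x 0 = p /\ y 0 = q /\
      is_minimal_period x y (2 * PI) /\ forall t, Rabs (x t) < eps.
Proof.
  intros W D HF Heps. pose proof (radius_pos _ _ _ W) as HR.
  destruct (proj1 (continuous_eps _ _)
              (continuous_position g a b 0 W ltac:(lra)) (mkposreal _ Heps)) as [e1 He1].
  simpl in He1. rewrite position_0 in He1 by assumption.
  (* An amplitude below [eta] lies inside the well and has |X| below [eps]. *)
  set (eta := Rmin e1 (radius g a)).
  assert (Heta : 0 < eta /\ eta <= e1 /\ eta <= radius g a).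
  { pose proof (cond_pos e1). unfold eta, Rmin. destruct Rle_dec; lra. }
  assert (Heta2 : 0 < eta / 2) by lra.
  pose proof (well_zero _ _ _ W) as Hab.
  destruct (filter_and _ _ (well_near_0 _ _ _ W)
     (proj1 (continuous_eps _ _)
        (continuous_amplitude g a b 0 W ltac:(lra)) (mkposreal _ Heta2))) as [d1 Hd1].
  simpl in Hd1. rewrite amplitude_0 in Hd1.
  (* With this d the initial amplitude u and velocity q are both below eta/2 in absolute value,
     hence rho = sqrt (u^2 + q^2) is below [eta]. *)
  assert (Hd : exists d, 0 < d /\ d <= d1 /\ d <= eta / 2).
  { exists (Rmin d1 (eta / 2)). pose proof (cond_pos d1). unfold Rmin.
    destruct Rle_dec; lra. }
  destruct Hd as (d & Hd0 & Hdd1 & Hdeta). exists d. split; [exact Hd0|].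
  intros p q Hpq.
  assert (Hp : Rabs p < d) by (apply Rabs_def1; nra).
  destruct (Hd1 p) as [Hpab Hpu].
  { change (Rabs (p - 0) < d1). rewrite Rminus_0_r. lra. }
  rewrite Rminus_0_r in Hpu. apply Rabs_def2 in Hpu.
  set (u := amplitude g p) in *.
  assert (Hpos : 0 < u ^ 2 + q ^ 2).
  { destruct (Req_dec p 0) as [->|Hp0].
    - pose proof (pow2_ge_0 u). nra.
    - pose proof (amplitude_sign g a b p W ltac:(lra) Hp0) as Hs. fold u in Hs.
      assert (u <> 0) by (intros E; rewrite E in Hs; lra).
      pose proof (pow2_gt_0 u ltac:(assumption)). pose proof (pow2_ge_0 q). lra. }
  set (rho := sqrt (u ^ 2 + q ^ 2)).
  assert (Hr0 : 0 < rho) by now apply sqrt_lt_R0.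
  assert (Er : u ^ 2 + q ^ 2 = rho ^ 2) by (unfold rho; rewrite pow2_sqrt; lra).
  assert (Hr : rho < eta).
  { assert (q ^ 2 < d ^ 2) by (pose proof (pow2_ge_0 p); lra).
    assert (d ^ 2 <= (eta / 2) ^ 2) by nra.
    assert (u ^ 2 < (eta / 2) ^ 2) by nra. nra. }
  destruct (polar_coordinates u q rho Hr0 Er) as (s0 & Eu & Eq).
  destruct (isochronous_orbit g l r a b rho s0 W D HF ltac:(lra))
    as (x & y & Sol & X0 & Y0 & Per & Ran).
  exists x, y. repeat (split; try assumption).
  - rewrite X0, <- Eu. unfold u. apply position_amplitude; auto.
  - rewrite Y0. auto.
  - intros t. destruct (Ran t) as [s ->].
    specialize (He1 (rho * sin s)). rewrite Rminus_0_r in He1. apply He1.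
    change (Rabs (rho * sin s - 0) < e1). rewrite Rminus_0_r.
    pose proof (sin_scal_range rho eta s ltac:(lra)). apply Rabs_def1; lra.
Qed.

(** * Uniqueness of small solutions and the isochronous center *)

Lemma force_lipschitz (g : R -> R) (a b : R) :
  well g a b -> exists eps, 0 < eps /\ forall x y,
    Rabs x < eps -> Rabs y < eps -> Rabs (g x - g y) <= 2 * Rabs (x - y).
Proof.
  intros W. pose proof (well_zero _ _ _ W) as Hab.
  pose proof (well_derive2 _ _ _ W 0 ltac:(lra)) as D2.
  (* Since g'(0) = 1 and g' is continuous, |g' - 1| < 1 near the origin; hence the Lipschitz
     constant 2. *)
  destruct (filter_and _ _ (well_near_0 _ _ _ W)
     (proj1 (continuous_eps _ _) (is_derive_continuous _ _ _ D2) (mkposreal 1 Rlt_0_1)))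
    as [e He].
  simpl in He. rewrite (well_slope0 _ _ _ W) in He.
  exists e. split; [apply cond_pos|]. intros x y Hx Hy.
  apply Rabs_def2 in Hx. apply Rabs_def2 in Hy.
  assert (Hin : forall z, Rmin y x <= z <= Rmax y x -> ball 0 e z).
  { intros z Hz. change (Rabs (z - 0) < e). rewrite Rminus_0_r. revert Hz.
    unfold Rmin, Rmax. destruct Rle_dec; intros; apply Rabs_def1; lra. }
  destruct (MVT_gen g y x (Derive g)) as [z [Hz Ez]].
  - intros z Hz. apply (well_derive _ _ _ W).
    destruct (He z) as [H _]; [apply Hin|]; lra.
  - intros z Hz. apply continuity_pt_filterlim.
    eapply is_derive_continuous, (well_derive _ _ _ W).
    destruct (He z) as [H _]; [apply Hin|]; lra.
  - rewrite Ez, Rabs_mult. apply Rmult_le_compat_r; [apply Rabs_pos|].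
    destruct (He z (Hin z Hz)) as [_ H]. apply Rabs_def2 in H. apply Rabs_le. lra.
Qed.

(* Gronwall: the squared distance [d] of two solutions satisfies [|d'| <= 3 d]. *)
Lemma solution_unique (g : R -> R) (l r : Rbar) (eps : R) (x1 y1 x2 y2 : R -> R) :
  (forall x y, Rabs x < eps -> Rabs y < eps -> Rabs (g x - g y) <= 2 * Rabs (x - y)) ->
  is_solution g l r x1 y1 -> is_solution g l r x2 y2 ->
  (forall t, Rabs (x1 t) < eps) -> (forall t, Rabs (x2 t) < eps) ->
  x1 0 = x2 0 -> y1 0 = y2 0 ->
  forall t, x1 t = x2 t /\ y1 t = y2 t.
Proof.
  intros Lip S1 S2 B1 B2 X0 Y0.
  set (d := fun t => (x1 t - x2 t) ^ 2 + (y1 t - y2 t) ^ 2).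
  set (dd := fun t => 2 * (x1 t - x2 t) * (y1 t - y2 t)
                      - 2 * (y1 t - y2 t) * (g (x1 t) - g (x2 t))).
  (* With A, B, C the absolute differences of x, y and g, and C <= 2 A: 2 A B + 2 B C <= 6 A B <= 3
     (A^2 + B^2). *)
  assert (Hdd : forall t, Rabs (dd t) <= 3 * d t).
  { intros t. unfold dd, d.
    pose proof (Lip (x1 t) (x2 t) (B1 t) (B2 t)) as HL.
    rewrite <- (pow2_abs (x1 t - x2 t)), <- (pow2_abs (y1 t - y2 t)).
    eapply Rle_trans; [apply Rabs_triang|]. rewrite Rabs_Ropp, !Rabs_mult.
    rewrite (Rabs_pos_eq 2) by lra.
    revert HL. generalize (Rabs_pos (x1 t - x2 t)) (Rabs_pos (y1 t - y2 t)).
    generalize (Rabs (x1 t - x2 t)), (Rabs (y1 t - y2 t)), (Rabs (g (x1 t) - g (x2 t))).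
    intros A B C HA HB HL. assert (B * C <= B * (2 * A)) by now apply Rmult_le_compat_l.
    pose proof (pow2_ge_0 (A - B)). nra. }
  assert (d0 : d 0 = 0) by (unfold d; rewrite X0, Y0; ring).
  assert (De : forall k t, is_derive (fun s => d s * exp (k * s)) t
                 ((dd t + k * d t) * exp (k * t))).
  { intros k t. destruct (S1 t) as (_ & Dx1 & Dy1). destruct (S2 t) as (_ & Dx2 & Dy2).
    unfold d. auto_derive.
    - repeat (split; [eexists; eassumption|]). easy.
    - replace (Derive (fun s => x1 s) t) with (y1 t) by (symmetry; now apply is_derive_unique).
      replace (Derive (fun s => x2 s) t) with (y2 t) by (symmetry; now apply is_derive_unique).
      replace (Derive (fun s => y1 s) t) with (- g (x1 t)) by (symmetry; now apply is_derive_unique).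
      replace (Derive (fun s => y2 s) t) with (- g (x2 t)) by (symmetry; now apply is_derive_unique).
      unfold dd. simpl. ring. }
  assert (Hd : forall t, d t = 0).
  { intros t. apply Rle_antisym; [|unfold d; pose proof (pow2_ge_0 (x1 t - x2 t));
                                    pose proof (pow2_ge_0 (y1 t - y2 t)); lra].
    (* Then d(s) exp(k s) cannot grow when s moves away from 0 towards t, in either direction of
       time, and it vanishes at s = 0. *)
    set (k := if Rle_dec 0 t then -3 else 3).
    destruct (MVT_gen (fun s => d s * exp (k * s)) 0 t
                (fun s => (dd s + k * d s) * exp (k * s))) as [z [Hz Ez]].
    - intros z _. exact (De k z).
    - intros z _. apply continuity_pt_filterlim.
      exact (is_derive_continuous _ _ _ (De k z)).
    - rewrite d0, Rmult_0_l, !Rminus_0_r in Ez.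
      pose proof (Hdd z) as Hz1. apply Rabs_le_between in Hz1.
      pose proof (exp_pos (k * z)). pose proof (exp_pos (k * t)).
      assert ((dd z + k * d z) * exp (k * z) * t <= 0).
      { unfold k in *. destruct Rle_dec.
        - assert ((dd z + -3 * d z) * exp (-3 * z) <= 0) by nra. nra.
        - assert (0 <= (dd z + 3 * d z) * exp (3 * z)) by nra. nra. }
      nra. }
  intros t. specialize (Hd t). unfold d in Hd.
  pose proof (pow2_ge_0 (x1 t - x2 t)). pose proof (pow2_ge_0 (y1 t - y2 t)).
  assert (E1 : (x1 t - x2 t) ^ 2 = 0) by lra.
  assert (E2 : (y1 t - y2 t) ^ 2 = 0) by lra.
  split; nra.
Qed.

Lemma isochronous_center (g : R -> R) (l r : Rbar) (a b : R) :
  well g a b -> (forall x, a <= x <= b -> in_dom l r x) ->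
  (forall x, a < x < b -> calF g x = 0) ->
  is_isochronous_center g l r.
Proof.
  intros W D HF. destruct (force_lipschitz g a b W) as (eps & Heps & Lip).
  destruct (isochronous_orbits_near_0 g l r a b eps W D HF Heps) as (d & Hd & Orb).
  split.
  - exists d. split; [exact Hd|]. intros p q Hpq.
    destruct (Orb p q Hpq) as (x & y & Sol & X0 & Y0 & Per & _).
    now exists x, y, (2 * PI).
  (* The bound [d] provides a constructed orbit through the initial point, and [eps] keeps the given
     solution where uniqueness holds. *)
  - set (d' := Rmin d eps).
    assert (Hd' : 0 < d' /\ d' <= d /\ d' <= eps).
    { unfold d', Rmin. destruct Rle_dec; lra. }
    exists d', (2 * PI). split; [lra|].
    intros x y T Sol (HT & HP & Hmin) Hsmall.
    assert (Hx : forall t, Rabs (x t) < eps).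
    { intros t. pose proof (Hsmall t). pose proof (pow2_ge_0 (y t)).
      apply Rabs_def1; nra. }
    destruct (Req_dec (x 0 ^ 2 + y 0 ^ 2) 0) as [E0|N0].
    (* By uniqueness a solution starting at the origin is constant, so T/2 would be a smaller
       period. *)
    + exfalso.
      assert (E1 : x 0 = 0).
      { pose proof (pow2_ge_0 (x 0)). pose proof (pow2_ge_0 (y 0)).
        assert (x 0 ^ 2 = 0) by lra. nra. }
      assert (E2 : y 0 = 0).
      { pose proof (pow2_ge_0 (x 0)). pose proof (pow2_ge_0 (y 0)).
        assert (y 0 ^ 2 = 0) by lra. nra. }
      assert (S0 : is_solution g l r (fun _ => 0) (fun _ => 0)).
      { intros t. split; [|split].
        - apply (D 0). pose proof (well_zero _ _ _ W). lra.
        - apply (is_derive_const (V := R_NormedModule)).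
        - rewrite (well_force0 _ _ _ W), Ropp_0.
          apply (is_derive_const (V := R_NormedModule)). }
      assert (U : forall t, x t = 0 /\ y t = 0).
      { apply (solution_unique g l r eps x y (fun _ => 0) (fun _ => 0) Lip Sol S0 Hx); auto.
        intros _. rewrite Rabs_R0. exact Heps. }
      assert (T <= T / 2); [|lra].
      apply Hmin; [lra|]. intros t. destruct (U t) as [-> ->].
      destruct (U (t + T / 2)) as [-> ->]. auto.
    + assert (Hpq : 0 < x 0 ^ 2 + y 0 ^ 2 < d ^ 2).
      { pose proof (Hsmall 0). pose proof (pow2_ge_0 (x 0)). pose proof (pow2_ge_0 (y 0)).
        split; nra. }
      destruct (Orb _ _ Hpq) as (x2 & y2 & Sol2 & X0 & Y0 & (H2 & P2 & M2) & B2).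
      pose proof (solution_unique g l r eps x y x2 y2 Lip Sol Sol2 Hx B2
                    (eq_sym X0) (eq_sym Y0)) as U.
      apply Rle_antisym.
      * apply Hmin; [exact H2|]. intros t.
        destruct (U t) as [-> ->]. destruct (U (t + 2 * PI)) as [-> ->]. apply P2.
      * apply M2; [exact HT|]. intros t.
        destruct (U t) as [<- <-]. destruct (U (t + T)) as [<- <-]. apply HP.
Qed.

Theorem mainTheorem6 (g : R -> R) (l r : Rbar)
  (dom0 : in_dom l r 0)
  (g_analytic : forall x, in_dom l r x -> analytic_at g x)
  (g0 : g 0 = 0)
  (dg0 : Derive g 0 = 1)
  (H : exists c a b, turning_points g l r c a b) :
  ((forall x : R, Rbar_lt (left_end g l r) x -> Rbar_lt x (right_end g l r) ->
      x <> 0 -> 0 < calF g x) ->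
   forall c : R, 0 < c -> Rbar_lt c (energy_sup g l r) ->
     ex_derive (period g l r) c /\ 0 < Derive (period g l r) c)
  /\
  ((forall x : R, Rbar_lt (left_end g l r) x -> Rbar_lt x (right_end g l r) ->
      x <> 0 -> calF g x < 0) ->
   forall c : R, 0 < c -> Rbar_lt c (energy_sup g l r) ->
     ex_derive (period g l r) c /\ Derive (period g l r) c < 0)
  /\
  ((forall x : R, Rbar_lt (left_end g l r) x -> Rbar_lt x (right_end g l r) ->
      calF g x = 0) ->
   is_isochronous_center g l r)
  /\
  ((forall x : R, Rbar_lt (left_end g l r) x -> Rbar_lt x (right_end g l r) ->
      calF g x = 0)
   <->
   (forall x : R, Rbar_lt (left_end g l r) x -> Rbar_lt x (right_end g l r) ->
      x <> 0 ->
      is_derive (fun s => potential g s / g s ^ 2) x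
        (alpha g + beta g * potential g x))).
Proof.
  assert (W : forall c a b, turning_points g l r c a b -> well g a b).
  { intros c a b. now apply turning_points_well. }
  split; [|split; [|split]].
  - intros HF c Hc Hsup. rewrite <- (Rmult_1_l (Derive _ c)).
    apply Derive_period_sign; auto. intros x Hl Hr Hx. rewrite Rmult_1_l. auto.
  - intros HF c Hc Hsup.
    destruct (Derive_period_sign g l r (-1) c) as [E D]; auto.
    + intros x Hl Hr Hx. pose proof (HF x Hl Hr Hx). lra.
    + split; [exact E|lra].
  - intros HF. destruct H as (c & a & b & T).
    apply isochronous_center with a b.
    + now apply W with c.
    + destruct T as (Da & Db & _). intros x. now apply in_dom_between.
    + intros x Hx. destruct (turning_points_ends _ _ _ _ _ _ _ T Hx). auto.
  - split.
    + intros HF x Hl Hr Hx0.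
      destruct (ends_turning_points g l r x Hl Hr Hx0) as (c & a & b & Hx & T).
      apply (calF_0_iff g a b x (W c a b T) Hx Hx0), HF; assumption.
    (* The equation is silent at 0, where G/g^2 has the form 0/0; there calF vanishes because g and
       G do. *)
    + intros HD x Hl Hr. destruct (Req_dec x 0) as [->|Hx0].
      * unfold calF. rewrite g0, potential_0. ring.
      * destruct (ends_turning_points g l r x Hl Hr Hx0) as (c & a & b & Hx & T).
        apply (calF_0_iff g a b x (W c a b T) Hx Hx0), HD; assumption.
Qed.
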